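(* For every $\epsilon>0$ there is a constant $C>0$ such that for all $f\in L^{4/3}(\mathbb{H},|z_2|^{-\epsilon})$ and all $\lambda>0$, $$\left|\{(z_1,z_2)\in\mathbb{H} : |P(f)(z_1,z_2)|>\lambda\}\right| \le \frac{C\,\|f\|^{4/3}_{L^{4/3}(\mathbb{H},|z_2|^{-\epsilon})}}{\lambda^{4/3}}.$$
   Context: $\mathbb{H}=\{(z_1,z_2)\in\mathbb{C}^2:|z_1|<|z_2|<1\}$, $dV$ Lebesgue measure, $|U|$ Lebesgue measure of $U$. The Bergman projection is $P(f)(z)=\int_{\mathbb{H}}K_{\mathbb{H}}(z;\bar w)f(w)\,dV(w)$, $K_{\mathbb{H}}(z_1,z_2;\bar w_1,\bar w_2)=\frac{1}{\pi^2 z_2\bar w_2(1-\frac{z_1\bar w_1}{z_2\bar w_2})^2(1-z_2\bar w_2)^2}$. For a positive weight $\mu$, $\|f\|^p_{L^p(\mathbb{H},\mu)}=\int_{\mathbb{H}}|f|^p\mu\,dV$. *)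

(* Defs.v *)
From HB Require Import structures.
From mathcomp Require Import all_boot all_order all_algebra.
From mathcomp Require Import all_classical all_reals all_analysis.
From mathcomp Require Import complex.

Set Implicit Arguments.
Unset Strict Implicit.
Unset Printing Implicit Defensive.

Import Order.TTheory GRing.Theory Num.Theory.
Local Open Scope classical_set_scope.
Local Open Scope ring_scope.
Local Open Scope complex_scope.

(* points of C^2 in real coordinates: (x1, (y1, (x2, y2))) stands for
   (z1, z2) = (x1 + i y1, x2 + i y2); each factor is R with its Borel
   measurable structure (measurableTypeR R, convertible to R). *)
Definition C2pt (R : realType) :=
  (measurableTypeR R * (measurableTypeR R * (measurableTypeR R * measurableTypeR R)))%type.

Definition zc1 {R : realType} (p : C2pt R) : R[i] := (p.1 : R) +i* (p.2.1 : R).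
Definition zc2 {R : realType} (p : C2pt R) : R[i] := (p.2.2.1 : R) +i* (p.2.2.2 : R).

Definition cmod {R : realType} (z : R[i]) : R := Normc.normc z.

(* Lebesgue measure on C^2 = R^4: the product of four copies of the
   Lebesgue measure on R.  (product_measure2 [\x^] only needs the left
   factor to be sigma-finite, which avoids a missing canonical
   sigma-finiteness instance for [\x].) *)
Definition vol (R : realType) : {measure set (C2pt R) -> \bar R} :=
  ((@lebesgue_measure R) \x^ ((@lebesgue_measure R) \x^
   ((@lebesgue_measure R) \x^ (@lebesgue_measure R))))%E.

Definition Hartogs (R : realType) : set (C2pt R) :=
  [set p | cmod (zc1 p) < cmod (zc2 p) < 1].

Definition KH {R : realType} (z w : C2pt R) : R[i] :=
  let a1 := zc1 z in let a2 := zc2 z in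
  let b1 := conjc (zc1 w) in let b2 := conjc (zc2 w) in
  ((pi%:C) ^+ 2 * a2 * b2 * (1 - (a1 * b1) / (a2 * b2)) ^+ 2
     * (1 - a2 * b2) ^+ 2)^-1.

Definition cintegral {R : realType} (D : set (C2pt R)) (g : C2pt R -> R[i]) : R[i] :=
  (Rintegral (@vol R) D (fun x => complex.Re (g x))) +i* (Rintegral (@vol R) D (fun x => complex.Im (g x))).

Definition Bproj {R : realType} (f : C2pt R -> R[i]) (z : C2pt R) : R[i] :=
  cintegral (@Hartogs R) (fun w => KH z w * f w).

Definition cmeasurable {R : realType} (D : set (C2pt R)) (f : C2pt R -> R[i]) : Prop :=
  measurable_fun D (fun x => complex.Re (f x)) /\ measurable_fun D (fun x => complex.Im (f x)).

Definition wpow_int {R : realType} (p : R) (mu : C2pt R -> R) (f : C2pt R -> R[i]) : \bar R :=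
  (\int[@vol R]_(x in @Hartogs R) ((cmod (f x)) `^ p * mu x)%:E)%E.

Definition wz2 {R : realType} (eps : R) (x : C2pt R) : R := (cmod (zc2 x)) `^ (- eps).

Definition inLp_w {R : realType} (p : R) (mu : C2pt R -> R) (f : C2pt R -> R[i]) : Prop :=
  cmeasurable (@Hartogs R) f /\ (wpow_int p mu f < +oo)%E.

(* Main.v *)
Require Import Defs.
From HB Require Import structures.
From mathcomp Require Import all_boot all_order all_algebra.
From mathcomp Require Import all_classical all_reals all_analysis.
From mathcomp Require Import complex.
From mathcomp Require Import measurable_realfun.
From mathcomp Require Import ring lra.
Import Order.TTheory GRing.Theory Num.Theory.
Import numFieldNormedType.Exports.
Local Open Scope classical_set_scope.
Local Open Scope ring_scope.

(* A Schur test.  With A(z) = 1 - |z1|/|z2| and B(z) = 1 - |z2|, the two disc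
   factors of the kernel give, for 0 < s < 1 and 0 < g < 2,
     int_H |K(z,w)| (A B)(w)^-s |w2|^-(1+g) dV(w) <= C |z2|^-1 (A B)(z)^-s.
   Put g = 2 - 3 e with e <= eps and W = (A B)^-s |w2|^-(1+g).  The elementary
   inequality u <= u^(4/3) c^(-1/3) + c, used with u = |f(w)| and c = eta W(w)
   for a suitable eta = eta(z), bounds int |K||f| by
     eta^(-1/3) int |K| |f|^(4/3) W^(-1/3)  +  lambda/4.
   On the set |P f| > lambda the first term is therefore at least lambda/4.
   Integrating in z, exchanging the integrals, and applying the estimate above
   with s/3 in place of s leaves int |f|^(4/3) |w2|^-e. *)

(** * Nonnegative integrals and product measures *)

Section nonneg_integral.
Local Open Scope ereal_scope.
Context {d} {T : measurableType d} {R : realType}.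
Context (mu : {measure set T -> \bar R}).

(** What happens at w2 = 0 fixes the exponents. On the slice |w1| < |w2| the kernel bound carries a
    factor |w2|, which the 1 in 1 + g cancels; the |w2|^(-g) left over is integrable on the unit
    disc only when g < 2. The final exchange leaves |w2|^((1 + g)/3 - 1), which is |w2|^(-e) exactly
    when g = 2 - 3 e. So e = 0 would call for the divergent case g = 2, and the weight |z2|^(-eps)
    pays for the difference. The power s > 0 is there because the integral of |1 - b conj(w)|^(-2)
    over the unit disc grows like a logarithm as |b| tends to 1; the boundary weight (1 - |w|)^(-s)
    turns this into a bound of its own shape. The disc integrals are done in Cartesian coordinates:
    the kernel is replaced by the inverse square of a maximum of three distances, and a splitting
    into sectors reduces it to one-dimensional power integrals. *)

Lemma le_integral_ge0 (D : set T) (f g : T -> \bar R) :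
  (forall x, D x -> 0 <= f x) -> (forall x, D x -> f x <= g x) ->
  \int[mu]_(x in D) f x <= \int[mu]_(x in D) g x.
Proof.
move=> f0 fg; have g0 x : D x -> 0 <= g x.
  by move=> Dx; exact: le_trans (f0 x Dx) (fg x Dx).
(* A nonnegative integral is the supremum over simple functions below the integrand, so monotonicity
   comes without measurability of [f] or [g]; iterated integrals can thus be bounded from the
   inside. *)
rewrite !ge0_integralE//; apply: le_ereal_sup => _ /= [h hf <-]; exists h => //.
by move=> x; apply: (le_trans (hf x)); apply: lee_restrict.
Qed.

End nonneg_integral.

Section product.
Local Open Scope ereal_scope.
Context d1 d2 (T1 : measurableType d1) (T2 : measurableType d2) (R : realType).
Context (m1 : {sigma_finite_measure set T1 -> \bar R}).
Context (m2 : {sigma_finite_measure set T2 -> \bar R}).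

Lemma product_measure2_sigma_finite : sigma_finite setT (m1 \x^ m2).
Proof.
have /sigma_finiteP[F [TF ndF Foo]] := sigma_finiteT m1.
have /sigma_finiteP[G [TG ndG Goo]] := sigma_finiteT m2.
exists (fun n => F n `*` G n).
  rewrite -setXTT TF TG predeqE => -[x y]; split.
    move=> [/= [n _ Fnx] [k _ Gky]]; exists (maxn n k) => //; split.
    - by move: x Fnx; exact/subsetPset/ndF/leq_maxl.
    - by move: y Gky; exact/subsetPset/ndG/leq_maxr.
  by move=> [n _ []/= ? ?]; split; exists n.
move=> k; have [? ?] := Foo k; have [? ?] := Goo k.
split; first exact: measurableX.
by rewrite product_measure2E// lte_mul_pinfty// ge0_fin_numE.
Qed.


(** [\x] and [\x^] agree on measurable rectangles, hence everywhere; this brings Tonelli to the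
    product that [vol] is made of. *)
Lemma tonelli_product_measure2 (f : T1 * T2 -> \bar R) :
  measurable_fun setT f -> (forall x, 0 <= f x) ->
  \int[m1 \x^ m2]_z f z = \int[m2]_y \int[m1]_x f (x, y).
Proof.
move=> mf f0.
rewrite -[RHS](fubini_tonelli2 (m1 := m1) (m2 := m2))//.
apply: eq_measure_integral => /= A mA _; apply/esym.
by apply: product_measure_unique => //= *; rewrite product_measure2E.
Qed.

End product.

Definition product_sf d1 d2 (T1 : measurableType d1) (T2 : measurableType d2)
    (R : realType) (m1 : {sigma_finite_measure set T1 -> \bar R})
    (m2 : {sigma_finite_measure set T2 -> \bar R}) :
    {sigma_finite_measure set (T1 * T2)%type -> \bar R} :=
  HB.pack (m1 \x^ m2)%E (Measure_isSigmaFinite.Build _ _ _ (m1 \x^ m2)%E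
    (product_measure2_sigma_finite _ _ _ _ _ m1 m2)).

Section volume.
Local Open Scope ereal_scope.
Context {R : realType}.
Notation lam := (@lebesgue_measure R).

(** Convertible to [vol], with the sigma-finite structure used by the Fubini-Tonelli lemmas. *)
Definition vol_sf : {sigma_finite_measure set (C2pt R) -> \bar R} :=
  product_sf _ _ _ _ _ lam (product_sf _ _ _ _ _ lam (product_sf _ _ _ _ _ lam lam)).

(** The order keeps w2 = (x2, y2) outside, so that the slice in w1 is integrated for a fixed radius
    |w2|. *)
Lemma vol_tonelli (F : C2pt R -> \bar R) : measurable_fun setT F ->
  (forall w, 0 <= F w) ->
  \int[@vol R]_w F w =
  \int[lam]_y2 \int[lam]_x2 \int[lam]_y1 \int[lam]_x1 F (x1, (y1, (x2, y2))).
Proof.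
move=> mF F0.
have mF3 := @measurable_fun_fubini_tonelli_G _ _ _ _ R lam F mF F0.
have F30 p : 0 <= fubini_G lam F p by apply: integral_ge0.
have mF2 := @measurable_fun_fubini_tonelli_G _ _ _ _ R lam _ mF3 F30.
have F20 p : 0 <= fubini_G lam (fubini_G lam F) p by apply: integral_ge0.
etransitivity; first exact: (tonelli_product_measure2 _ _ _ _ _ lam
  (product_sf _ _ _ _ _ lam (product_sf _ _ _ _ _ lam lam)) F mF F0).
etransitivity; first exact: (tonelli_product_measure2 _ _ _ _ _ lam
  (product_sf _ _ _ _ _ lam lam) _ mF3 F30).
exact: (tonelli_product_measure2 _ _ _ _ _ lam lam _ mF2 F20).
Qed.

End volume.

Section affine.
Context {R : realType}.
Notation lam := (@lebesgue_measure R).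

(** Lebesgue measure is determined by its values on half-open intervals, so invariance of these
    under [phi] is enough. *)
Let lebesgue_pushforward (phi : measurableTypeR R -> measurableTypeR R)
    (mphi : measurable_fun setT phi) (f : R -> \bar R) :
  (forall X, ocitv X -> lam X = lam (phi @^-1` X)) ->
  measurable_fun setT f -> (forall x, 0 <= f x)%E ->
  (\int[lam]_x f (phi x) = \int[lam]_x f x)%E.
Proof.
move=> H mf f0.
have := @ge0_integral_pushforward _ _ _ _ R _ mphi lam setT f measurableT mf (fun x _ => f0 x).
rewrite preimage_setT => <-.
apply/esym; apply: eq_measure_integral => A mA _.
exact: (@lebesgue_measure_unique R (pushforward lam phi)).
Qed.

Lemma integral_reflect (c : R) (f : R -> \bar R) :
  measurable_fun setT f -> (forall x, 0 <= f x)%E ->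
  (\int[lam]_x f (c - x)%R = \int[lam]_x f x)%E.
Proof.
apply: (lebesgue_pushforward (fun x => c - x)%R).
  exact: measurable_funB.
move=> X /ocitvP[->|[[a b] /= ab ->]]; first by rewrite preimage_set0.
have -> : (fun x : R => c - x)%R @^-1` `]a, b] = `[c - b, c - a[%classic :> set R.
  by apply/seteqP; split => x /=; rewrite !in_itv/= => /andP[? ?]; apply/andP; split; lra.
rewrite !lebesgue_measure_itv/= !lte_fin.
rewrite ltrD2l ltrN2.
by case: ifP => // _; rewrite -!EFinB; congr EFin; lra.
Qed.

Lemma integral_translate (c : R) (f : R -> \bar R) :
  measurable_fun setT f -> (forall x, 0 <= f x)%E ->
  (\int[lam]_x f (x + c)%R = \int[lam]_x f x)%E.
Proof.
apply: (lebesgue_pushforward (fun x => x + c)%R).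
  exact: measurable_funD.
move=> X /ocitvP[->|[[a b] /= ab ->]]; first by rewrite preimage_set0.
have -> : (fun x : R => x + c)%R @^-1` `]a, b] = `]a - c, b - c]%classic :> set R.
  by apply/seteqP; split => x /=; rewrite !in_itv/= => /andP[? ?]; apply/andP; split; lra.
rewrite !lebesgue_measure_itv/= !lte_fin ltrD2r.
by case: ifP => // _; rewrite -!EFinB; congr EFin; lra.
Qed.

End affine.

(** * One-dimensional power integrals *)

Section powR_integrals.
Context {R : realType}.
Notation lam := (@lebesgue_measure R).

Lemma continuous_powR_gt0 (e x : R) : 0 < x -> {for x, continuous (fun t : R => t `^ e)}.
Proof.
move=> x0; apply: differentiable_continuous; apply/derivable1_diffP.
by apply: derivable_powR; rewrite in_itv/= x0.
Qed.

Lemma integral_powR_cc (e a b : R) : e != 0 -> 0 < a -> a < b ->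
  (\int[lam]_(t in `[a, b]) (t `^ (e - 1))%:E = ((b `^ e - a `^ e) / e)%:E)%E.
Proof.
move=> e0 a0 ab.
have cF x : 0 < x -> {for x, continuous (fun t : R => t `^ e / e)}.
  by move=> x0; apply: cvgMl; exact: continuous_powR_gt0.
rewrite (@continuous_FTC2 R _ (fun t => t `^ e / e))//.
- by rewrite -EFinB -mulrBl.
- apply: continuous_in_subspaceT => x; rewrite inE/= in_itv/= => /andP[ax _].
  by apply: continuous_powR_gt0; exact: lt_le_trans ax.
- split.
  + move=> x; rewrite in_itv/= => /andP[ax _].
    apply: derivableM => //; apply: derivable_powR.
    by rewrite in_itv/= (lt_trans a0 ax).
  + by apply: cvg_at_right_filter; exact: cF.
  + by apply: cvg_at_left_filter; apply: cF; exact: lt_trans ab.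
- move=> x; rewrite in_itv/= => /andP[ax _].
  have x0 := lt_trans a0 ax.
  rewrite derive1E deriveM//; last by apply: derivable_powR; rewrite in_itv/= x0.
  rewrite derive_cst scaler0 add0r -derive1E powR_derive1 ?in_itv/= ?x0//.
  by rewrite /GRing.scale/= mulrA mulVf// mul1r.
Qed.

(** Monotone convergence along an exhaustion; it carries bounds on compact intervals over to
    improper integrals. *)
Lemma integral_bigcup_le (f : R -> R) (F : (set R)^nat) (c : \bar R) :
  nondecreasing_seq F -> (forall n, measurable (F n)) ->
  (forall n, measurable_fun (F n) f) -> (forall x, 0 <= f x) ->
  (forall n, (\int[lam]_(t in F n) (f t)%:E <= c)%E) ->
  (\int[lam]_(t in \bigcup_n F n) (f t)%:E <= c)%E.
Proof.
move=> ndF mF mf f0 H.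
have cv := @ge0_nondecreasing_set_cvg_integral _ (measurableTypeR R) R F (EFin \o f) lam ndF mF
  (fun i => (measurable_EFinP _ _).2 (mf i)) (fun i x _ => f0 x).
rewrite -(cvg_lim _ cv)//; apply: lime_le; first by apply/cvg_ex; eexists; exact: cv.
by apply: nearW => n; exact: H.
Qed.

Lemma integral_powR_near0 (e m : R) : 0 < e -> 0 < m ->
  (\int[lam]_(t in `]0%R, m]) (t `^ (e - 1))%:E <= (m `^ e / e)%:E)%E.
Proof.
move=> e0 m0.
(* The shift [n.+2] keeps the lower end strictly below [m] even for n = 0, as [integral_powR_cc]
   requires. *)
have -> : `]0, m]%classic = \bigcup_n `[m / n.+2%:R, m]%classic :> set R.
  apply/seteqP; split => [x /=|x [n _] /=]; rewrite !in_itv/=.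
    move=> /andP[x0 xm]; exists (Num.truncn (m / x)) => //=.
    rewrite in_itv/= xm andbT ler_pdivrMr// mulrC -ler_pdivrMr//.
    by rewrite ltW// (lt_trans (truncnS_gt _))// ltr_nat.
  by move=> /andP[mx ->]; rewrite andbT (lt_le_trans _ mx)// divr_gt0.
apply: integral_bigcup_le => //.
- move=> i j ij; apply/subsetPset => x /=; rewrite !in_itv/= => /andP[mx ->].
  rewrite andbT (le_trans _ mx)// ler_pM2l// lef_pV2 ?posrE//.
  by rewrite ler_nat.
- by move=> n; apply: measurable_funTS.
- by move=> x; exact: powR_ge0.
move=> n; rewrite integral_powR_cc ?gt_eqF//; last 2 first.
- by rewrite divr_gt0.
- by rewrite ltr_pdivrMr// ltr_pMr// ltr1n.
by rewrite lee_fin ler_pM2r ?invr_gt0// lerBlDr lerDl powR_ge0.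
Qed.

Lemma integral_powR_infty (e m : R) : 0 < e -> 0 < m ->
  (\int[lam]_(t in `[m, +oo[) (t `^ (- e - 1))%:E <= (m `^ (- e) / e)%:E)%E.
Proof.
move=> e0 m0.
have -> : `[m, +oo[%classic = \bigcup_n `[m, m * n.+2%:R]%classic :> set R.
  apply/seteqP; split => [x /=|x [n _] /=]; rewrite !in_itv/=; last by case/andP => ->.
  rewrite andbT => xm; exists (Num.truncn (x / m)) => //=.
  rewrite in_itv/= xm/= mulrC -ler_pdivrMr//.
  by rewrite ltW// (lt_trans (truncnS_gt _))// ltr_nat.
apply: integral_bigcup_le => //.
- move=> i j ij; apply/subsetPset => x /=; rewrite !in_itv/= => /andP[-> mx] /=.
  by rewrite (le_trans mx)// ler_pM2l// ler_nat.
- by move=> n; apply: measurable_funTS.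
- by move=> x; exact: powR_ge0.
move=> n; rewrite integral_powR_cc ?oppr_eq0 ?gt_eqF//; last first.
  by rewrite ltr_pMr// ltr1n.
rewrite lee_fin invrN mulrN -mulNr ler_pM2r ?invr_gt0//.
by rewrite opprB lerBlDr lerDl powR_ge0.
Qed.

(** Cut at t = m: below, the integrand is m^(-alpha) t^(-s), integrable at 0 as s < 1; above, it is
    t^(-alpha-s), integrable at infinity as alpha + s > 1. Both pieces scale like m^(1-alpha-s). For
    t <= 0 the integrand contains a nonzero power of 0 and vanishes. *)
Lemma integral_max_powR (alpha s m : R) : 0 < s -> s < 1 -> 1 < alpha + s -> 0 < m ->
  (\int[lam]_t ((Num.max m t) `^ (- alpha) * (Num.max t 0) `^ (- s))%:E <=
   (((1 - s)^-1 + (alpha + s - 1)^-1) * m `^ (1 - alpha - s))%:E)%E.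
Proof.
move=> s0 s1 as1 m0.
pose h1 (t : R) : \bar R := (m `^ (- alpha) * t `^ (- s))%:E.
pose h2 (t : R) : \bar R := (t `^ (- (alpha + s - 1) - 1))%:E.
have m1 : measurable_fun setT h1.
  by apply/measurable_EFinP; apply: measurable_funM.
have m2 : measurable_fun setT h2 by apply/measurable_EFinP.
have h10 t : (0 <= h1 t)%E by rewrite lee_fin mulr_ge0// powR_ge0.
have h20 t : (0 <= h2 t)%E by rewrite lee_fin powR_ge0.
have bnd (t : R) : (((Num.max m t) `^ (- alpha) * (Num.max t 0) `^ (- s))%:E <=
    (h1 \_ `]0%R, m]) t + (h2 \_ `[m, +oo[) t)%E.
  have [t0|t0] := leP t 0.
    rewrite powR0 ?mulr0 ?oppr_eq0 ?gt_eqF//.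
    by apply: adde_ge0; apply: erestrict_ge0.
  have [mt|mt] := leP m t.
    rewrite [X in (_ <= _ + X)%E]patchE mem_set/=; last by rewrite in_itv/= mt.
    rewrite -[leLHS]add0e; apply: leeD; first by apply: erestrict_ge0.
    rewrite /h2 lee_fin -powRD; last by rewrite (gt_eqF t0) implybT.
    by rewrite (_ : - (alpha + s - 1) - 1 = - alpha - s)//; ring.
  rewrite [X in (_ <= X + _)%E]patchE mem_set/=; last by rewrite in_itv/= t0 ltW.
  by rewrite -[leLHS]adde0; apply: leeD => //; apply: erestrict_ge0.
apply: (@le_trans _ _ (\int[lam]_t ((h1 \_ `]0%R, m]) t + (h2 \_ `[m, +oo[) t))%E).
  by apply: le_integral_ge0 => t _; [rewrite lee_fin mulr_ge0// powR_ge0|exact: bnd].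
rewrite ge0_integralD//; last 4 first.
- by move=> x _; apply: erestrict_ge0.
- by apply/(measurable_restrictT h1) => //; exact: measurable_funTS.
- by move=> x _; apply: erestrict_ge0.
- by apply/(measurable_restrictT h2) => //; exact: measurable_funTS.
rewrite -!integral_mkcond mulrDl EFinD; apply: leeD.
  under eq_integral do rewrite /h1 EFinM.
  rewrite ge0_integralZl_EFin ?powR_ge0//; last 2 first.
  - by move=> x _; rewrite lee_fin powR_ge0.
  - by apply/measurable_EFinP; exact: measurable_funTS.
  have := integral_powR_near0 (1 - s) m; rewrite subr_gt0 => /(_ s1 m0) H.
  rewrite (_ : 1 - s - 1 = - s) in H; last by ring.
  apply: le_trans; first by apply: lee_wpmul2l; [rewrite lee_fin powR_ge0|exact: H].
  rewrite -EFinM lee_fin mulrA -powRD; last by rewrite (gt_eqF m0) implybT.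
  by rewrite mulrC (_ : - alpha + (1 - s) = 1 - alpha - s)//; ring.
apply: (le_trans (integral_powR_infty _ _ _ m0)); first by rewrite subr_gt0.
by rewrite lee_fin mulrC (_ : - (alpha + s - 1) = 1 - alpha - s)//; ring.
Qed.

End powR_integrals.

(** * Integrals over a disc *)

Section measurability_lemmas.
Context {d} {T : measurableType d} {R : realType}.

Lemma measurable_fun_sqrt (f : T -> R) :
  measurable_fun setT f -> measurable_fun setT (fun x => Num.sqrt (f x)).
Proof.
move=> mf; apply: measurableT_comp mf.
by apply: continuous_measurable_fun; exact: sqrt_continuous.
Qed.

Lemma measurable_fun_norm (f : T -> R) :
  measurable_fun setT f -> measurable_fun setT (fun x => `|f x|).
Proof. exact: (measurableT_comp (@normr_measurable R setT)). Qed.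

Lemma measurable_fun_opp (f : T -> R) :
  measurable_fun setT f -> measurable_fun setT (fun x => - f x).
Proof. exact: (measurableT_comp (@oppr_measurable R setT)). Qed.

Lemma measurable_fun_powR (f : T -> R) (p : R) :
  measurable_fun setT f -> measurable_fun setT (fun x => f x `^ p).
Proof. exact: (measurableT_comp (@measurable_powR R p)). Qed.

Context {d1 d2} {T1 : measurableType d1} {T2 : measurableType d2}.

Lemma measurable_fun_fst (f : T -> T1 * T2) :
  measurable_fun setT f -> measurable_fun setT (fun x => (f x).1).
Proof. by move=> mf; exact: (measurableT_comp (f := fst) _ mf). Qed.

Lemma measurable_fun_snd (f : T -> T1 * T2) :
  measurable_fun setT f -> measurable_fun setT (fun x => (f x).2).
Proof. by move=> mf; exact: (measurableT_comp (f := snd) _ mf). Qed.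

End measurability_lemmas.

Ltac measurability :=
  lazymatch goal with
  | |- measurable_fun _ (fun _ => ?c) => exact: measurable_cst
  | |- measurable_fun _ (fun x => x) => exact: measurable_id
  | |- measurable_fun _ fst => exact: measurable_fst
  | |- measurable_fun _ snd => exact: measurable_snd
  | |- measurable_fun _ (fun x => (_)%:E) => apply/measurable_EFinP; measurability
  | |- measurable_fun _ (fun x => _ + _) => apply: measurable_funD; measurability
  | |- measurable_fun _ (fun x => - _) => apply: measurable_fun_opp; measurability
  | |- measurable_fun _ (fun x => _ * _) => apply: measurable_funM; measurability
  | |- measurable_fun _ (fun x => Num.max _ _) => apply: measurable_maxr; measurability
  | |- measurable_fun _ (fun x => `|_|) => apply: measurable_fun_norm; measurability
  | |- measurable_fun _ (fun x => Num.sqrt _) => apply: measurable_fun_sqrt; measurability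
  | |- measurable_fun _ (fun x => _ ^+ _) => apply: measurable_funX; measurability
  | |- measurable_fun _ (fun x => _ `^ _) => apply: measurable_fun_powR; measurability
  | |- measurable_fun _ (fun x => (_).1) => apply: measurable_fun_fst; measurability
  | |- measurable_fun _ (fun x => (_).2) => apply: measurable_fun_snd; measurability
  | |- measurable_fun ?D (Num.max ?m) =>
      apply: (measurable_maxr (f := fun=> m) (g := fun x => x)); measurability
  | |- measurable_fun ?D (GRing.add ?m) =>
      apply: (measurable_funD (f := fun=> m) (g := fun x => x)); measurability
  | |- measurable_fun ?D (GRing.mul ?m) =>
      apply: (measurable_funM (f := fun=> m) (g := fun x => x)); measurability
  | |- measurable_fun ?D -%R => exact: oppr_measurable
  | |- measurable_fun ?D Num.norm => exact: normr_measurable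
  | |- _ => idtac
  end.

Definition hypot {R : realType} (x y : R) : R := Num.sqrt (x ^+ 2 + y ^+ 2).

(** Negative powers take the value 0, not infinity, at 0, so some bounds below fail at one point.
    Adding to [g] a function infinite at [c] and zero elsewhere restores the bound without changing
    the integral. *)
Lemma le_integral_off_point {R : realType} (c : R) (f g : R -> \bar R) :
  measurable_fun setT g -> (forall x, 0 <= f x)%E ->
  (forall x, 0 <= g x)%E -> (forall x, x != c -> f x <= g x)%E ->
  (\int[@lebesgue_measure R]_x f x <= \int[@lebesgue_measure R]_x g x)%E.
Proof.
move=> mg f0 g0 fg.
pose h (x : measurableTypeR R) : \bar R := (if x == c then +oo else 0)%E.
have h0 x : (0 <= h x)%E by rewrite /h; case: ifP.
have mh : measurable_fun setT h.
  apply: measurable_fun_ifT => //; apply: (measurable_fun_bool true).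
  rewrite setTI (_ : _ @^-1` _ = [set c]); first exact: measurable_set1.
  by apply/seteqP; split => x /= /eqP.
have ih : (\int[@lebesgue_measure R]_x h x = 0)%E.
  have mc : measurable ([set: measurableTypeR R] `\ c).
    by apply: measurableD => //; exact: measurable_set1.
  rewrite -(@integral_setD1 R h c setT mc); last exact: measurable_funTS.
  apply: integral0_eq => x [_ /= /eqP xc].
  by rewrite /h (negbTE xc).
have -> : (\int[@lebesgue_measure R]_x g x = \int[@lebesgue_measure R]_x (g x + h x))%E.
  by rewrite ge0_integralD// ih adde0.
apply: le_integral_ge0 => // x _.
rewrite /h; case: ifPn => [_|xc]; last by rewrite adde0 fg.
by rewrite addey ?leey// gt_eqF// (lt_le_trans _ (g0 x)).
Qed.

Section disk.
Context {R : realType}.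
Notation lam := (@lebesgue_measure R).
Implicit Types (s d b rho : R).

(** Serves integrands that depend on an absolute value: for either sign one of the two affine copies
    of [g] bounds the integrand, and so does the sum. *)
Lemma integral_reflect_sum (g : R -> R) (c c' C : R) :
  measurable_fun setT g -> (forall t, 0 <= g t) ->
  (\int[lam]_t (g t)%:E <= C%:E)%E ->
  (\int[lam]_y (g (c - y) + g (y + c'))%:E <= (2 * C)%:E)%E.
Proof.
move=> mg g0 H.
have mg1 : measurable_fun setT (fun y : measurableTypeR R => g (c - y)).
  by apply: (measurableT_comp mg); measurability.
have mg2 : measurable_fun setT (fun y : measurableTypeR R => g (y + c')).
  by apply: (measurableT_comp mg); measurability.
under eq_integral do rewrite EFinD.
rewrite ge0_integralD//; last 4 first.
- by move=> x _; rewrite lee_fin.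
- exact/measurable_EFinP.
- by move=> x _; rewrite lee_fin.
- exact/measurable_EFinP.
rewrite (integral_reflect c (EFin \o g)); last 2 first.
- exact/measurable_EFinP.
- by move=> x; rewrite lee_fin.
rewrite (integral_translate c' (EFin \o g)); last 2 first.
- exact/measurable_EFinP.
- by move=> x; rewrite lee_fin.
by rewrite mulr2n mulrDl !mul1r EFinD leeD.
Qed.

(* The factor (max t 0)^-s makes the function vanish for t <= 0, because
   0 `^ (- s) = 0; the same convention replaces indicator functions below. *)
Definition strip s d b (Y : R -> R) (x y : R) : R :=
  let t := Y x - `|y| in
  (Num.max (Num.max d `|x - b|) t) `^ (- 2) * (Num.max t 0) `^ (- s).

(** For fixed x, [integral_max_powR] in t = Y x - |y| gives m^(-1-s) with m = max(d, |x - b|); a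
    second use in |x - b| gives d^(-s). [Y] enters only as a translation, whence a constant uniform
    in [Y] and [b]. *)
Lemma strip_integral s : 0 < s -> s < 1 -> exists C : R, 0 < C /\
  forall d b (Y : R -> R), 0 < d ->
  (\int[lam]_x \int[lam]_y (strip s d b Y x y)%:E <= (C * d `^ (- s))%:E)%E.
Proof.
move=> s0 s1.
have h1 : 0 < (1 - s)^-1 by rewrite invr_gt0 subr_gt0.
have h2 : 0 < (2 + s - 1)^-1 by rewrite invr_gt0; lra.
have h3 : 0 < (1 - s / 2)^-1 by rewrite invr_gt0; lra.
have h4 : 0 < (1 + s / 2 + s / 2 - 1)^-1 by rewrite invr_gt0; lra.
pose C1 := (1 - s)^-1 + (2 + s - 1)^-1.
pose C2 := (1 - s / 2)^-1 + (1 + s / 2 + s / 2 - 1)^-1.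
have C10 : 0 < C1 by rewrite addr_gt0.
have C20 : 0 < C2 by rewrite addr_gt0.
exists ((2 * C1) * (2 * C2)); split; first by rewrite !mulr_gt0.
move=> d b Y d0.
have inner (x : R) : (\int[lam]_y (strip s d b Y x y)%:E <=
    (2 * (C1 * (Num.max d `|x - b|) `^ (- 1 - s)))%:E)%E.
  pose m := Num.max d `|x - b|.
  have m0 : 0 < m by rewrite lt_max d0.
  pose g (t : R) := (Num.max m t) `^ (- 2) * (Num.max t 0) `^ (- s).
  have mg : measurable_fun setT g by rewrite /g; measurability.
  have g0 t : 0 <= g t by rewrite mulr_ge0// powR_ge0.
  have ig : (\int[lam]_t (g t)%:E <= (C1 * m `^ (- 1 - s))%:E)%E.
    have := @integral_max_powR R 2 s m s0 s1 _ m0.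
    rewrite (_ : 1 - 2 - s = - 1 - s); last by ring.
    by apply; lra.
  apply: le_trans (integral_reflect_sum g (Y x) (Y x) _ mg g0 ig).
  apply: le_integral_ge0 => y _; first by rewrite lee_fin mulr_ge0// powR_ge0.
  rewrite lee_fin -/m.
  have [y0|y0] := leP 0 y.
    have -> : strip s d b Y x y = g (Y x - y) by rewrite /strip (ger0_norm y0).
    by rewrite lerDl.
  have -> : strip s d b Y x y = g (y + Y x) by rewrite /strip (ltr0_norm y0) opprK (addrC (Y x)).
  by rewrite lerDr.
apply: (@le_trans _ _ (\int[lam]_x (2 * (C1 * (Num.max d `|x - b|) `^ (- 1 - s)))%:E)%E).
  apply: le_integral_ge0 => x _; last exact: inner.
  by apply: integral_ge0 => y _; rewrite lee_fin mulr_ge0// powR_ge0.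
under eq_integral do rewrite mulrA EFinM.
rewrite ge0_integralZl_EFin//; last 3 first.
- by move=> x _; rewrite lee_fin powR_ge0.
- by measurability.
- by rewrite mulr_ge0// ltW.
rewrite -(mulrA (2 * C1)) [leRHS]EFinM; apply: lee_wpmul2l.
  by rewrite lee_fin mulr_ge0// ltW.
(* The exponent 1 + s is split into 1 + s/2 and s/2, and the second part is moved from max(d, u) to
   u, so that [integral_max_powR] applies with singular exponent s/2. *)
pose g (t : R) := (Num.max d t) `^ (- (1 + s / 2)) * (Num.max t 0) `^ (- (s / 2)).
have mg : measurable_fun setT g by rewrite /g; measurability.
have g0 t : 0 <= g t by rewrite mulr_ge0// powR_ge0.
have ig : (\int[lam]_t (g t)%:E <= (C2 * d `^ (- s))%:E)%E.
  have := @integral_max_powR R (1 + s / 2) (s / 2) d _ _ _ d0.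
  rewrite (_ : 1 - (1 + s / 2) - s / 2 = - s); last by field.
  by apply; lra.
rewrite -mulrA.
have key (u : R) : 0 < u -> (Num.max d u) `^ (- 1 - s) <= g u.
  move=> u0; rewrite /g [Num.max u 0]max_l; last exact: ltW.
  have M0 : 0 < Num.max d u by rewrite lt_max d0.
  rewrite (_ : - 1 - s = - (1 + s / 2) - s / 2); last by field.
  rewrite powRD; last by rewrite (gt_eqF M0) implybT.
  apply: ler_wpM2l; first exact: powR_ge0.
  rewrite !powRN lef_pV2 ?posrE ?powR_gt0//.
  apply: ge0_ler_powR; rewrite ?nnegrE; [lra|exact: ltW|exact: ltW|].
  by rewrite le_max lexx orbT.
apply: (le_trans _ (integral_reflect_sum g b (- b) _ mg g0 ig)).
apply: (le_integral_off_point b).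
- apply/measurable_EFinP; apply: measurable_funD.
  + by apply: (measurableT_comp mg); measurability.
  + by apply: (measurableT_comp mg); measurability.
- by move=> x; rewrite lee_fin powR_ge0.
- by move=> x; rewrite lee_fin addr_ge0.
move=> x xb; rewrite lee_fin.
have [xb0|xb0|/eqP] := ltgtP x b; last by rewrite (negbTE xb).
  rewrite ltr0_norm ?subr_lt0// opprB (le_trans (key _ _)) ?subr_gt0//.
  by rewrite lerDl.
rewrite gtr0_norm ?subr_gt0// (le_trans (key _ _)) ?subr_gt0//.
by rewrite lerDr.
Qed.

End disk.

Section powR_facts.
Context {R : realType}.
Implicit Types (x y p : R).

Lemma powRN_anti x y p : 0 <= p -> 0 < x -> x <= y -> y `^ (- p) <= x `^ (- p).
Proof.
move=> p0 x0 xy; have y0 := lt_le_trans x0 xy.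
rewrite !powRN lef_pV2 ?posrE ?powR_gt0//.
by apply: ge0_ler_powR => //; rewrite nnegrE ltW.
Qed.

Lemma powRN_scale x y p k : 0 <= p -> 0 < k -> 0 < y -> y <= k * x ->
  x `^ (- p) <= k `^ p * y `^ (- p).
Proof.
move=> p0 k0 y0 yx.
have -> : k `^ p * y `^ (- p) = (k^-1 * y) `^ (- p).
  by rewrite powRM ?ltW ?invr_gt0// -powR_inv1 ?ltW// -powRrM mulN1r opprK.
apply: powRN_anti => //; first by rewrite mulr_gt0 ?invr_gt0.
by rewrite ler_pdivrMl.
Qed.

End powR_facts.

Section hypot_facts.
Context {R : realType}.
Implicit Types x y : R.

Lemma hypotC x y : hypot x y = hypot y x.
Proof. by rewrite /hypot addrC. Qed.

Lemma hypot_ge0 x y : 0 <= hypot x y.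
Proof. exact: sqrtr_ge0. Qed.

Lemma sqr_hypot x y : hypot x y ^+ 2 = x ^+ 2 + y ^+ 2.
Proof. by rewrite sqr_sqrtr// addr_ge0// sqr_ge0. Qed.

Lemma ler_norm_hypotl x y : `|x| <= hypot x y.
Proof. by rewrite -sqrtr_sqr ler_sqrt ?lerDl ?addr_ge0 ?sqr_ge0. Qed.

Lemma ler_norm_hypotr x y : `|y| <= hypot x y.
Proof. by rewrite hypotC ler_norm_hypotl. Qed.

End hypot_facts.

Section disk.
Context {R : realType}.
Notation lam := (@lebesgue_measure R).
Implicit Types (s d b rho x y : R).

(** The maximum bounds |rho^2 - b conj(w)| / rho from below in the disc of radius rho
    ([le_normc_pseudohyperbolic]), so this stands for the Bergman kernel of that disc times the
    boundary weight (rho - |w|)^(-s). *)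
Definition disk_kernel s rho b1 b2 x y : R :=
  (Num.max (Num.max (rho - hypot b1 b2) (hypot (x - b1) (y - b2)))
    (rho - hypot x y)) `^ (- 2) * (Num.max (rho - hypot x y) 0) `^ (- s).

Lemma disk_kernel_ge0 s rho b1 b2 x y : 0 <= disk_kernel s rho b1 b2 x y.
Proof. by rewrite mulr_ge0 ?powR_ge0. Qed.

Lemma disk_kernelC s rho b1 b2 x y :
  disk_kernel s rho b1 b2 x y = disk_kernel s rho b2 b1 y x.
Proof.
by rewrite /disk_kernel (hypotC b1) (hypotC x) (hypotC (x - b1)).
Qed.

(* In the sector |x| <= |y| the distance rho - |w| to the circle is comparable
   to the vertical distance sqrt (rho^2 - x^2) - |y|. *)
Lemma disk_kernel_strip s rho b1 b2 x y : 0 < s -> s < 1 ->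
  hypot b1 b2 < rho -> `|x| <= `|y| ->
  disk_kernel s rho b1 b2 x y <= 27 *
    strip s (rho - hypot b1 b2) b1 (fun x => Num.sqrt (rho ^+ 2 - x ^+ 2)) x y.
Proof.
move=> s0 s1 brho xy.
have rho0 : 0 < rho by exact: le_lt_trans (hypot_ge0 _ _) brho.
have r0 := hypot_ge0 x y.
rewrite /disk_kernel /strip; set d := rho - hypot b1 b2.
have d0 : 0 < d by rewrite subr_gt0.
set Y := Num.sqrt _; set t := Y - `|y|; set H := hypot (x - b1) _.
have XH : `|x - b1| <= H by exact: ler_norm_hypotl.
have [u0|u0] := lerP (rho - hypot x y) 0.
  rewrite powR0 ?mulr0; last by rewrite oppr_eq0 gt_eqF.
  by rewrite mulr_ge0// mulr_ge0 ?powR_ge0.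
have xy2 : x ^+ 2 <= y ^+ 2 by rewrite -ler_sqr ?nnegrE// !real_normK ?num_real in xy *.
have hr : hypot x y ^+ 2 < rho ^+ 2.
  by rewrite ltr_sqr ?nnegrE// ?ltW// -subr_gt0.
have hr' := hr; rewrite sqr_hypot in hr'.
have y2 : `|y| ^+ 2 = y ^+ 2 by rewrite real_normK ?num_real.
have Y2 : Y ^+ 2 = rho ^+ 2 - x ^+ 2 by rewrite sqr_sqrtr//; nra.
have Y0 : 0 <= Y by exact: sqrtr_ge0.
have t0 : 0 < t.
  by rewrite subr_gt0 -ltr_sqr ?nnegrE// Y2 y2; lra.
(* In the sector x^2 <= rho^2 / 2, so Y >= rho / sqrt 2 > 2 rho / 3. *)
have Yrho : 2 * rho <= 3 * Y.
  by rewrite leNgt; apply/negP => h; nra.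
(* Both products in [E] equal rho^2 - x^2 - y^2, so t / (rho - |w|) = (rho + |w|) / (Y + |y|) <= 2
   rho / Y <= 3. *)
have tu : t <= 3 * (rho - hypot x y).
  have E : (rho - hypot x y) * (rho + hypot x y) = t * (Y + `|y|).
    have := sqr_hypot x y; rewrite /t; nra.
  have r1 : hypot x y < rho by rewrite -subr_gt0.
  have := normr_ge0 y; nra.
set u := rho - hypot x y in u0 tu *.
set M := Num.max (Num.max d `|x - b1|) t.
set N := Num.max (Num.max d H) u.
have M0 : 0 < M by rewrite !lt_max d0.
have N0 : 0 < N by rewrite !lt_max d0.
have MN : M <= 3 * N.
  have dN : d <= N by rewrite !le_max lexx.
  have HN : H <= N by rewrite !le_max lexx orbT.
  have uN : u <= N by rewrite le_max lexx orbT.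
  by rewrite !ge_max; apply/andP; split; [apply/andP; split|]; lra.
rewrite [Num.max t 0]max_l; last exact: ltW.
(* The factor 27 is 3^2 from the squared maximum times 3 >= 3^s from the boundary weight. *)
have A : N `^ (- 2) <= 9 * M `^ (- 2).
  have -> : 9 = 3 `^ 2 :> R by rewrite (powR_mulrn 2 (ler0n _ 3)); ring.
  exact: powRN_scale.
have B : u `^ (- s) <= 3 * t `^ (- s).
  apply: (le_trans (@powRN_scale R u t s 3 (ltW s0) _ t0 tu)) => //.
  by rewrite ler_wpM2r ?powR_ge0// -[leRHS]powRr1// ler_powR ?ler1n// ltW.
apply: (le_trans (ler_pM _ _ A B)); rewrite ?powR_ge0//.
by rewrite le_eqVlt; apply/orP; left; apply/eqP; ring.
Qed.

(** A Forelli-Rudin estimate. Each point lies in the sector |x| <= |y| or in its mirror image, which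
    [disk_kernelC] exchanges, so two strip integrals, centred at b1 and b2, cover the disc. *)
Lemma disk_integral s : 0 < s -> s < 1 -> exists C : R, 0 < C /\
  forall rho b1 b2, hypot b1 b2 < rho ->
  (\int[lam]_y \int[lam]_x (disk_kernel s rho b1 b2 x y)%:E <=
    (C * (rho - hypot b1 b2) `^ (- s))%:E)%E.
Proof.
move=> s0 s1; have [C [C0 HC]] := @strip_integral R s s0 s1.
exists (27 * (2 * C)); split; first by rewrite !mulr_gt0.
move=> rho b1 b2 brho; set d := rho - _.
have d0 : 0 < d by rewrite subr_gt0.
pose Y (x : R) := Num.sqrt (rho ^+ 2 - x ^+ 2).
pose A b (p : measurableTypeR R * measurableTypeR R) : \bar R :=
  (strip s d b Y p.1 p.2)%:E.
have mA b : measurable_fun setT (A b) by rewrite /A /strip /Y; measurability.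
have A0 b p : (0 <= A b p)%E by rewrite lee_fin mulr_ge0// powR_ge0.
have bnd (x y : R) :
    ((disk_kernel s rho b1 b2 x y)%:E <= 27%:E * (A b1 (x, y) + A b2 (y, x)))%E.
  have [xy|/ltW yx] := leP `|x| `|y|.
    apply: (@le_trans _ _ (27%:E * A b1 (x, y))%E).
      by rewrite -EFinM lee_fin; exact: disk_kernel_strip.
    by apply: lee_wpmul2l => //; rewrite leeDl.
  apply: (@le_trans _ _ (27%:E * A b2 (y, x))%E).
    rewrite -EFinM lee_fin disk_kernelC /d hypotC.
    by apply: disk_kernel_strip => //; rewrite hypotC.
  by apply: lee_wpmul2l => //; rewrite leeDr.
have mA1 b (y : measurableTypeR R) : measurable_fun setT (fun x : measurableTypeR R => A b (x, y)).
  by apply: measurableT_comp (mA b) _; exact: measurable_pair2.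
have mA2 b (y : measurableTypeR R) : measurable_fun setT (fun x : measurableTypeR R => A b (y, x)).
  by apply: measurableT_comp (mA b) _; exact: measurable_pair1.
have inner (y : R) : (\int[lam]_x (disk_kernel s rho b1 b2 x y)%:E <=
    27%:E * (\int[lam]_x A b1 (x, y) + \int[lam]_x A b2 (y, x)))%E.
  rewrite -ge0_integralD// -ge0_integralZl_EFin//; last 2 first.
  - by move=> x _; exact: adde_ge0.
  - exact: emeasurable_funD.
  by apply: le_integral_ge0 => x _; [rewrite lee_fin disk_kernel_ge0|exact: bnd].
apply: (@le_trans _ _ (\int[lam]_y (27%:E *
    (\int[lam]_x A b1 (x, y) + \int[lam]_x A b2 (y, x))))%E).
  apply: le_integral_ge0 => y _; last exact: inner.
  by apply: integral_ge0 => x _; rewrite lee_fin disk_kernel_ge0.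
have mG : measurable_fun setT (fun y : measurableTypeR R => \int[lam]_x A b1 (x, y))%E.
  exact: (@measurable_fun_fubini_tonelli_G _ _ _ _ R lam (A b1) (mA b1) (A0 b1)).
have mF : measurable_fun setT (fun y : measurableTypeR R => \int[lam]_x A b2 (y, x))%E.
  exact: (@measurable_fun_fubini_tonelli_F _ _ _ _ R lam (A b2) (mA b2) (A0 b2)).
have G0 y : (0 <= \int[lam]_x A b1 (x, y))%E by apply: integral_ge0.
have F0 y : (0 <= \int[lam]_x A b2 (y, x))%E by apply: integral_ge0.
rewrite ge0_integralZl_EFin//; last 2 first.
- by move=> y _; exact: adde_ge0.
- by apply: emeasurable_funD; [exact: mG|exact: mF].
rewrite -(mulrA 27) [leRHS]EFinM; apply: lee_wpmul2l => //.
rewrite ge0_integralD; [|exact: measurableT|by move=> y _; exact: G0|exact: mG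
  |by move=> y _; exact: F0|exact: mF].
have -> : ((2 * C * d `^ (- s))%:E = (C * d `^ (- s))%:E + (C * d `^ (- s))%:E)%E.
  by rewrite -EFinD; congr EFin; ring.
apply: leeD; last exact: HC.
(* [strip_integral] integrates the second variable first, so the order is exchanged here; the
   mirrored term already had it. *)
rewrite -(fubini_tonelli (m1 := lam) (m2 := lam) (A b1))//.
exact: HC.
Qed.

End disk.

(** * The unit disc with a power singularity at its centre *)

Section weighted_disk.
Context {R : realType}.
Notation lam := (@lebesgue_measure R).
Implicit Types (s g b x y : R).

Lemma powR_invN (k e : R) : 0 < k -> k^-1 `^ (- e) = k `^ e.
Proof.
by move=> k0; rewrite -[k^-1]powR_inv1 ?(ltW k0)// -powRrM mulrN mulN1r opprK.
Qed.

Lemma measurable_disk_kernel s rho b1 b2 :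
  measurable_fun setT (fun p : measurableTypeR R * measurableTypeR R =>
    disk_kernel s rho b1 b2 p.1 p.2).
Proof. by rewrite /disk_kernel /hypot; measurability. Qed.

(** Split at |w| = 1/2. Outside, |w|^(-g) <= 2^g <= 4. Inside, 1 - |w| >= 1/2 bounds the kernel by
    8, and |w|^(-g) is at most |x|^(-g/2) |y|^(-g/2), a product of one-variable functions; the
    maxima equal 1 there and serve integrability at infinity. *)
Lemma disk_kernel_weight s g b1 b2 x y : 0 < s -> s < 1 -> 0 < g -> g < 2 ->
  x != 0 -> y != 0 ->
  disk_kernel s 1 b1 b2 x y * (hypot x y) `^ (- g) <=
  4 * disk_kernel s 1 b1 b2 x y +
  8 * ((Num.max 1 `|x|) `^ (- 2) * `|x| `^ (- (g / 2)) *
      ((Num.max 1 `|y|) `^ (- 2) * `|y| `^ (- (g / 2)))).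
Proof.
move=> s0 s1 g0 g2 x0 y0; set W := (X in 8 * X).
have W0 : 0 <= W by rewrite !mulr_ge0 ?powR_ge0.
have K0 := disk_kernel_ge0 s 1 b1 b2 x y.
have xr := ler_norm_hypotl x y; have yr := ler_norm_hypotr x y.
have x0' : 0 < `|x| by rewrite normr_gt0.
have y0' : 0 < `|y| by rewrite normr_gt0.
have r0 : 0 < hypot x y by exact: lt_le_trans xr.
have p2 (e : R) : e <= 2 -> 2^-1 `^ (- e) <= 4.
  move=> e2; rewrite powR_invN//.
  have -> : 4 = 2 `^ 2 :> R by rewrite (powR_mulrn 2 (ler0n _ 2)); ring.
  by rewrite ler_powR// ler1n.
have [r1|r1] := leP (2^-1) (hypot x y).
  rewrite mulrC; apply: (@le_trans _ _ (4 * disk_kernel s 1 b1 b2 x y)).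
    apply: ler_wpM2r => //; apply: le_trans (p2 g _); last exact: ltW.
    by apply: powRN_anti => //; exact: ltW.
  by rewrite lerDl mulr_ge0.
have WE : W = `|x| `^ (- (g / 2)) * `|y| `^ (- (g / 2)).
  by rewrite /W !max_l ?powR1 ?mul1r//; lra.
apply: (@le_trans _ _ (8 * W)); last by rewrite lerDr mulr_ge0.
rewrite WE; apply: ler_pM => //; first exact: powR_ge0.
  rewrite /disk_kernel [Num.max (1 - hypot x y) 0]max_l; last by lra.
  have -> : 8 = 4 * 2 :> R by ring.
  have u2 : 2^-1 <= 1 - hypot x y by lra.
  apply: ler_pM; rewrite ?powR_ge0//.
    apply: le_trans (p2 2 _) => //; apply: powRN_anti => //.
    by rewrite le_max u2 orbT.
  apply: (@le_trans _ _ (2^-1 `^ (- s))); first by apply: powRN_anti => //; lra.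
  rewrite powR_invN// -[leRHS]powRr1//.
  by rewrite ler_powR ?ler1n// ltW.
have -> : - g = - (g / 2) - g / 2 by field.
rewrite powRD; last by rewrite (gt_eqF r0) implybT.
have g20 : 0 <= g / 2 by lra.
by apply: ler_pM; rewrite ?powR_ge0//; apply: powRN_anti.
Qed.

(** The hypothesis g < 2 enters as g/2 < 1, which makes |x|^(-g/2) integrable at 0. *)
Lemma integral_max_norm_powR g : 0 < g -> g < 2 -> exists C : R, 0 <= C /\
  (\int[lam]_x ((Num.max 1 `|x|) `^ (- 2) * `|x| `^ (- (g / 2)))%:E <= C%:E)%E.
Proof.
move=> g0 g2.
pose h t : R := (Num.max 1 t) `^ (- 2) * (Num.max t 0) `^ (- (g / 2)).
pose C : R := ((1 - g / 2)^-1 + (2 + g / 2 - 1)^-1) * 1 `^ (1 - 2 - g / 2).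
have mh : measurable_fun setT h by rewrite /h; measurability.
have h0 t : 0 <= h t by rewrite mulr_ge0// powR_ge0.
have ih : (\int[lam]_t (h t)%:E <= C%:E)%E.
  by apply: integral_max_powR; rewrite ?ltr01//; lra.
have C0 : 0 <= C.
  by rewrite mulr_ge0 ?powR_ge0// addr_ge0// invr_ge0; lra.
exists (2 * C); split; first by rewrite mulr_ge0.
apply: le_trans (integral_reflect_sum h 0 0 _ mh h0 ih).
apply: le_integral_ge0 => t _; first by rewrite lee_fin mulr_ge0// powR_ge0.
rewrite lee_fin sub0r addr0.
have [t0|t0] := leP 0 t.
  rewrite [leLHS](_ : _ = h t); first by rewrite lerDr.
  by rewrite (ger0_norm t0) /h (max_l t0).
rewrite [leLHS](_ : _ = h (- t)); first by rewrite lerDl.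
by rewrite (ltr0_norm t0) /h [Num.max (- t) 0]max_l// oppr_ge0 ltW.
Qed.

Lemma weighted_disk_integral s g : 0 < s -> s < 1 -> 0 < g -> g < 2 ->
  exists C : R, 0 < C /\ forall b1 b2, hypot b1 b2 < 1 ->
  (\int[lam]_y \int[lam]_x
     (disk_kernel s 1 b1 b2 x y * (hypot x y) `^ (- g))%:E <=
    (C * (1 - hypot b1 b2) `^ (- s))%:E)%E.
Proof.
move=> s0 s1 g0 g2.
have [C [C0 HC]] := @disk_integral R s s0 s1.
have [Cw [Cw0 HCw]] := integral_max_norm_powR g g0 g2.
exists (4 * C + 8 * Cw * Cw); split.
  by rewrite ltr_pwDl ?mulr_gt0// !mulr_ge0.
move=> b1 b2 b_lt1; set d := 1 - _.
have d0 : 0 < d by rewrite subr_gt0.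
pose W (t : R) := (Num.max 1 `|t|) `^ (- 2) * `|t| `^ (- (g / 2)).
have W0 t : 0 <= W t by rewrite mulr_ge0// powR_ge0.
have mW : measurable_fun setT W by rewrite /W; measurability.
pose K (p : measurableTypeR R * measurableTypeR R) : \bar R :=
  (disk_kernel s 1 b1 b2 p.1 p.2)%:E.
have mK : measurable_fun setT K by apply/measurable_EFinP; exact: measurable_disk_kernel.
have K0 p : (0 <= K p)%E by rewrite lee_fin disk_kernel_ge0.
have mK1 (y : measurableTypeR R) :
    measurable_fun setT (fun x : measurableTypeR R => K (x, y)).
  by apply: measurableT_comp mK _; exact: measurable_pair2.
pose I (y : measurableTypeR R) := (\int[lam]_x K (x, y))%E.
have mI : measurable_fun setT I.
  exact: (@measurable_fun_fubini_tonelli_G _ _ _ _ R lam K mK K0).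
have I0 y : (0 <= I y)%E by apply: integral_ge0.
have F0 (x y : R) : 0 <= disk_kernel s 1 b1 b2 x y * (hypot x y) `^ (- g).
  by rewrite mulr_ge0 ?disk_kernel_ge0 ?powR_ge0.
have inner (y : R) : y != 0 ->
    (\int[lam]_x (disk_kernel s 1 b1 b2 x y * (hypot x y) `^ (- g))%:E <=
     4%:E * I y + (8 * Cw)%:E * (W y)%:E)%E.
  move=> y0.
  apply: (@le_trans _ _ (\int[lam]_x (4%:E * K (x, y) + (8 * W y)%:E * (W x)%:E))%E).
    apply: (le_integral_off_point 0).
    - apply: emeasurable_funD; apply: measurable_funeM; first exact: mK1.
      exact/measurable_EFinP.
    - by move=> x; rewrite lee_fin.
    - move=> x; rewrite adde_ge0// ?mule_ge0// lee_fin ?mulr_ge0//.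
    move=> x x0; rewrite /K -!EFinM -EFinD lee_fin/=.
    rewrite (_ : 8 * W y * W x = 8 * (W x * W y)); last by ring.
    exact: disk_kernel_weight s g b1 b2 x y s0 s1 g0 g2 x0 y0.
  rewrite ge0_integralD; [|exact: measurableT| | | |]; last 4 first.
  - by move=> x _; rewrite mule_ge0.
  - by apply: measurable_funeM; exact: mK1.
  - by move=> x _; rewrite mule_ge0// lee_fin mulr_ge0.
  - by apply: measurable_funeM; exact/measurable_EFinP.
  rewrite !ge0_integralZl_EFin ?mulr_ge0//; last 2 first.
  - by move=> x _; rewrite lee_fin.
  - exact/measurable_EFinP.
  apply: leeD => //.
  apply: (@le_trans _ _ ((8 * W y)%:E * Cw%:E)%E).
    by apply: lee_wpmul2l; [rewrite lee_fin mulr_ge0|exact: HCw].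
  by rewrite -!EFinM lee_fin mulrAC.
apply: (@le_trans _ _ (\int[lam]_y (4%:E * I y + (8 * Cw)%:E * (W y)%:E))%E).
  apply: (le_integral_off_point 0).
  - apply: emeasurable_funD; apply: measurable_funeM; first exact: mI.
    exact/measurable_EFinP.
  - by move=> y; apply: integral_ge0 => x _; rewrite lee_fin.
  - by move=> y; rewrite adde_ge0// ?mule_ge0// lee_fin ?mulr_ge0.
  by move=> y y0; exact: inner.
rewrite ge0_integralD; [|exact: measurableT| | | |]; last 4 first.
- by move=> y _; rewrite mule_ge0.
- by apply: measurable_funeM; exact: mI.
- by move=> y _; rewrite mule_ge0// lee_fin mulr_ge0.
- by apply: measurable_funeM; exact/measurable_EFinP.
rewrite !ge0_integralZl_EFin ?mulr_ge0//; last 2 first.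
- by move=> y _; rewrite lee_fin.
- exact/measurable_EFinP.
rewrite (mulrDl (4 * C)) [leRHS]EFinD; apply: leeD.
  by rewrite -mulrA [leRHS]EFinM; apply: lee_wpmul2l => //; exact: HC.
apply: (@le_trans _ _ ((8 * Cw)%:E * Cw%:E)%E).
  by apply: lee_wpmul2l; [rewrite lee_fin mulr_ge0|exact: HCw].
(* The part near the origin contributes a constant, absorbed because (1 - |b|)^(-s) >= 1. *)
rewrite -EFinM lee_fin ler_peMr ?mulr_ge0//.
have -> : 1 = 1 `^ (- s) :> R by rewrite powR1.
by apply: powRN_anti; [exact: ltW|exact: d0|rewrite lerBlDr lerDl hypot_ge0].
Qed.

End weighted_disk.

(** * The Bergman kernel of the Hartogs triangle *)

Section kernel_bound.
Context {R : realType}.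
Implicit Types (z w b : R[i]) (rho : R).
Local Open Scope complex_scope.
Local Notation normc := (@Normc.normc R).

Lemma normc_hypot (x y : R) : normc (x +i* y) = hypot x y.
Proof. by []. Qed.

Lemma normc_ge0 z : 0 <= normc z.
Proof. by case: z => x y; exact: hypot_ge0. Qed.

Lemma normc_conj z : normc (conjc z) = normc z.
Proof. by case: z => x y; rewrite /= sqrrN. Qed.

Lemma normc_real (x : R) : 0 <= x -> normc x%:C = x.
Proof. by move=> x0; rewrite /= expr0n/= addr0 sqrtr_sqr ger0_norm. Qed.

Lemma normc_gt0 z : (0 < normc z) = (z != 0).
Proof.
rewrite lt_neqAle normc_ge0 andbT eq_sym; congr (~~ _).
by apply/eqP/eqP => [/Normc.eq0_normc|->]; [|exact: Normc.normc0].
Qed.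

(** The middle distance comes from the identity |rho^2 - b conj(w)|^2 - rho^2 |w - b|^2 = (rho^2 -
    |b|^2) (rho^2 - |w|^2) behind the pseudohyperbolic distance; the other two from the triangle
    inequality rho^2 - |b| |w| <= |rho^2 - b conj(w)|. *)
Lemma le_normc_pseudohyperbolic rho b w : 0 <= rho ->
  normc b <= rho -> normc w <= rho ->
  rho * Num.max (Num.max (rho - normc b) (normc (w - b))) (rho - normc w) <=
  normc ((rho ^+ 2)%:C - b * conjc w).
Proof.
move=> rho0 brho wrho; set D := normc ((rho ^+ 2)%:C - _).
have D0 : 0 <= D by exact: normc_ge0.
have b0 := normc_ge0 b; have w0 := normc_ge0 w; have h0 := normc_ge0 (w - b).
have tri : rho ^+ 2 - normc b * normc w <= D.
  have := le_normcD ((rho ^+ 2)%:C - b * conjc w) (b * conjc w).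
  by rewrite subrK normc_real ?sqr_ge0// Normc.normcM normc_conj lerBlDr.
have ph : rho * normc (w - b) <= D.
  rewrite -ler_sqr ?nnegrE ?mulr_ge0// exprMn /D.
  case: b w brho wrho {D D0 b0 w0 h0 tri} => b1 b2 [w1 w2].
  rewrite !normc_hypot => brho wrho.
  have hb := sqr_hypot b1 b2; have hw := sqr_hypot w1 w2.
  have eb : hypot b1 b2 ^+ 2 <= rho ^+ 2 by rewrite ler_sqr ?nnegrE ?hypot_ge0.
  have ew : hypot w1 w2 ^+ 2 <= rho ^+ 2 by rewrite ler_sqr ?nnegrE ?hypot_ge0.
  rewrite /= !sqr_sqrtr ?addr_ge0 ?sqr_ge0// -subr_ge0.
  rewrite [leRHS](_ : _ =
    (rho ^+ 2 - hypot b1 b2 ^+ 2) * (rho ^+ 2 - hypot w1 w2 ^+ 2)).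
    by rewrite mulr_ge0 ?subr_ge0.
  by rewrite hb hw; ring.
rewrite !maxr_pMr// !ge_max ph andbT.
by apply/andP; split; nra.
Qed.

(** The w1-slice is a disc of radius |w2|, and b is z1 rescaled into it: |w2|^2 (1 - z1 conj(w1) /
    (z2 conj(w2))) = |w2|^2 - b conj(w1). The disc bound is used there with rho = |w2|, and with rho
    = 1 in the second variable; the factor pi^(-2) <= 1 is dropped. *)
Lemma normc_KH_le (z w : C2pt R) : Hartogs z -> Hartogs w ->
  let b := zc1 z * zc2 w / zc2 z in
  cmod b = cmod (zc1 z) / cmod (zc2 z) * cmod (zc2 w) /\
  cmod (KH z w) <= (cmod (zc2 z))^-1 * cmod (zc2 w) *
  ((Num.max (Num.max (cmod (zc2 w) - cmod b) (cmod (zc1 w - b)))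
     (cmod (zc2 w) - cmod (zc1 w))) `^ (- 2) *
   (Num.max (Num.max (1 - cmod (zc2 z)) (cmod (zc2 w - zc2 z)))
     (1 - cmod (zc2 w))) `^ (- 2)).
Proof.
move=> Hz Hw; rewrite /KH /cmod; cbv zeta.
set Z1 := zc1 z; set Z2 := zc2 z; set W1 := zc1 w; set W2 := zc2 w.
have /andP[z12 z21] : normc Z1 < normc Z2 < 1 := Hz.
have /andP[w12 w21] : normc W1 < normc W2 < 1 := Hw.
have z0 := normc_ge0 Z1; have w0 := normc_ge0 W1.
have Z20 : 0 < normc Z2 by exact: le_lt_trans z12.
have W20 : 0 < normc W2 by exact: le_lt_trans w12.
have Z2n : Z2 != 0 by rewrite -normc_gt0.
have W2n : W2 != 0 by rewrite -normc_gt0.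
have W2c : conjc W2 != 0 by rewrite -normc_gt0 normc_conj.
set b := Z1 * W2 / Z2.
have nb : normc b = normc Z1 / normc Z2 * normc W2.
  by rewrite /b !Normc.normcM Normc.normcV mulrAC.
have brho : normc b < normc W2.
  by rewrite nb gtr_pMl// ltr_pdivrMr// mul1r.
split => //.
set N1 := Num.max _ (normc W2 - normc W1); set N2 := Num.max _ (1 - normc W2).
have N10 : 0 < N1 by rewrite lt_max subr_gt0 w12 orbT.
have N20 : 0 < N2 by rewrite lt_max subr_gt0 w21 orbT.
have H2 : N2 <= normc (1 - Z2 * conjc W2).
  have := @le_normc_pseudohyperbolic 1 Z2 W2 ler01 (ltW z21) (ltW w21).
  by rewrite mul1r expr1n.
have H1 : N1 <= normc (1 - Z1 * conjc W1 / (Z2 * conjc W2)) * normc W2.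
  have := @le_normc_pseudohyperbolic (normc W2) b W1 (ltW W20) (ltW brho) (ltW w12).
  rewrite -/N1 => h; rewrite -(ler_pM2l W20); apply: (le_trans h).
  have -> : (normc W2 ^+ 2)%:C = W2 * conjc W2.
    case: (W2) => x y; rewrite normc_hypot sqr_hypot.
    by apply/eqP; rewrite eq_complex /=; apply/andP; split; apply/eqP; ring.
  have -> : W2 * conjc W2 - b * conjc W1 =
      W2 * (1 - Z1 * conjc W1 / (Z2 * conjc W2)) * conjc W2.
    by rewrite /b; field; rewrite ?Z2n ?W2c.
  by rewrite !Normc.normcM normc_conj mulrA.
rewrite Normc.normcV !Normc.normcM normc_conj normc_real ?pi_ge0//.
rewrite -!expr2.
set P := normc (1 - _) in H1 *; set Q := normc (1 - _) in H2 *.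
have P0 : 0 < P by rewrite -(pmulr_lgt0 _ W20); exact: lt_le_trans H1.
have Q0 : 0 < Q by exact: lt_le_trans H2.
have E (x : R) : 0 < x -> x `^ (- 2) = (x ^+ 2)^-1.
  by move=> x0; rewrite powRN (powR_mulrn 2 (ltW x0)).
rewrite !E//.
have h1 : N1 ^+ 2 <= (P * normc W2) ^+ 2.
  by rewrite ler_sqr ?nnegrE ?mulr_ge0 ?(ltW N10) ?(ltW P0) ?(ltW W20).
have h2 : N2 ^+ 2 <= Q ^+ 2 by rewrite ler_sqr ?nnegrE ?(ltW N20) ?(ltW Q0).
have p1 : 1 <= (pi : R) ^+ 2 by have := @pi_ge2 R; nra.
rewrite -[X in _ <= _ * X * _]invrK -!invfM lef_pV2; last 2 first.
- by rewrite posrE !mulr_gt0 ?exprn_gt0 ?invr_gt0 ?pi_gt0.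
- by rewrite posrE !mulr_gt0 ?exprn_gt0 ?invr_gt0.
apply: (@le_trans _ _ (normc Z2 * (normc W2)^-1 * ((P * normc W2) ^+ 2 * Q ^+ 2))).
  by rewrite ler_pM2l ?mulr_gt0 ?invr_gt0// ler_pM ?sqr_ge0.
have -> : normc Z2 * (normc W2)^-1 * ((P * normc W2) ^+ 2 * Q ^+ 2) =
    normc Z2 * normc W2 * P ^+ 2 * Q ^+ 2.
  by field; rewrite gt_eqF.
rewrite -!(mulrA (pi ^+ 2)) ler_peMl// !mulr_ge0 ?sqr_ge0//; exact: ltW.
Qed.

End kernel_bound.

(** * Measurability of complex-valued functions *)

Section complex_measurability.
Context {d} {T : measurableType d} {R : realType}.
Implicit Types f g : T -> R[i].

Definition measurable_cfun f := measurable_fun setT (fun x => complex.Re (f x)) /\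
  measurable_fun setT (fun x => complex.Im (f x)).

Lemma measurable_cfun_cst (c : R[i]) : measurable_cfun (fun=> c).
Proof. by split; exact: measurable_cst. Qed.

Lemma measurable_cfunB f g : measurable_cfun f -> measurable_cfun g -> measurable_cfun (fun x => f x - g x).
Proof.
move=> [f1 f2] [g1 g2]; split.
- rewrite (_ : (fun x => complex.Re (f x - g x)) =
    (fun x => complex.Re (f x) - complex.Re (g x))); first exact: measurable_funB.
  by apply/funext => x; case: (f x) (g x) => a b [].
- rewrite (_ : (fun x => complex.Im (f x - g x)) =
    (fun x => complex.Im (f x) - complex.Im (g x))); first exact: measurable_funB.
  by apply/funext => x; case: (f x) (g x) => a b [].
Qed.

Lemma measurable_cfunM f g : measurable_cfun f -> measurable_cfun g -> measurable_cfun (fun x => f x * g x).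
Proof.
move=> [f1 f2] [g1 g2]; split.
- rewrite (_ : (fun x => complex.Re (f x * g x)) =
    (fun x => complex.Re (f x) * complex.Re (g x)
            - complex.Im (f x) * complex.Im (g x))).
    by apply: measurable_funB; exact: measurable_funM.
  by apply/funext => x; case: (f x) (g x) => a b [].
- rewrite (_ : (fun x => complex.Im (f x * g x)) =
    (fun x => complex.Re (f x) * complex.Im (g x)
            + complex.Im (f x) * complex.Re (g x))).
    by apply: measurable_funD; exact: measurable_funM.
  by apply/funext => x; case: (f x) (g x) => a b [].
Qed.

Lemma measurable_cfun_conj f : measurable_cfun f -> measurable_cfun (fun x => conjc (f x)).
Proof.
move=> [f1 f2]; split.
- rewrite (_ : (fun x => complex.Re _) = (fun x => complex.Re (f x)))//.
  by apply/funext => x; case: (f x).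
- rewrite (_ : (fun x => complex.Im _) = (fun x => - complex.Im (f x))).
    exact: measurable_fun_opp.
  by apply/funext => x; case: (f x).
Qed.

(** The inverse is the conjugate over the squared modulus, whose reciprocal is a real power; both
    conventions give 0 at 0. *)
Lemma measurable_cfunV f : measurable_cfun f -> measurable_cfun (fun x => (f x)^-1).
Proof.
move=> [f1 f2].
pose n x := complex.Re (f x) ^+ 2 + complex.Im (f x) ^+ 2.
have mn : measurable_fun setT (fun x => n x `^ (-1)).
  by apply: measurable_fun_powR; apply: measurable_funD; exact: measurable_funX.
have nV x : n x `^ (-1) = (n x)^-1 by rewrite powR_inv1// addr_ge0 ?sqr_ge0.
split.
- rewrite (_ : (fun x => complex.Re _) = (fun x => complex.Re (f x) * n x `^ (-1))).
    exact: measurable_funM.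
  by apply/funext => x; rewrite nV /n; case: (f x).
- rewrite (_ : (fun x => complex.Im _) = (fun x => - (complex.Im (f x) * n x `^ (-1)))).
    by apply: measurable_fun_opp; exact: measurable_funM.
  by apply/funext => x; rewrite nV /n; case: (f x).
Qed.

Lemma measurable_cmod f : measurable_cfun f -> measurable_fun setT (fun x => cmod (f x)).
Proof.
move=> [f1 f2]; rewrite (_ : (fun x => cmod _) =
    (fun x => Num.sqrt (complex.Re (f x) ^+ 2 + complex.Im (f x) ^+ 2))).
  by apply: measurable_fun_sqrt; apply: measurable_funD; exact: measurable_funX.
by apply/funext => x; case: (f x).
Qed.

End complex_measurability.

Section hartogs.
Context {R : realType}.
Notation lam := (@lebesgue_measure R).
Implicit Types (s g : R) (z w : C2pt R).

Lemma measurable_cfun_zc1 d (T : measurableType d) (h : T -> C2pt R) :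
  measurable_fun setT h -> measurable_cfun (fun x => zc1 (h x)).
Proof.
move=> mh; split; rewrite /zc1 /=; first exact: measurable_fun_fst.
by apply: measurable_fun_fst; exact: measurable_fun_snd.
Qed.

Lemma measurable_cfun_zc2 d (T : measurableType d) (h : T -> C2pt R) :
  measurable_fun setT h -> measurable_cfun (fun x => zc2 (h x)).
Proof.
move=> mh; split; rewrite /zc2 /=.
  by apply: measurable_fun_fst; apply: measurable_fun_snd; exact: measurable_fun_snd.
by apply: measurable_fun_snd; apply: measurable_fun_snd; exact: measurable_fun_snd.
Qed.

Lemma measurable_cfun_KH d (T : measurableType d) (h1 h2 : T -> C2pt R) :
  measurable_fun setT h1 -> measurable_fun setT h2 ->
  measurable_cfun (fun x => KH (h1 x) (h2 x)).
Proof.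
move=> m1 m2.
have a1 := measurable_cfun_zc1 _ _ _ m1; have a2 := measurable_cfun_zc2 _ _ _ m1.
have b1 := measurable_cfun_conj _ (measurable_cfun_zc1 _ _ _ m2); have b2 := measurable_cfun_conj _ (measurable_cfun_zc2 _ _ _ m2).
rewrite /KH; cbv zeta.
apply: measurable_cfunV; apply: measurable_cfunM.
  apply: measurable_cfunM; first by apply: measurable_cfunM => //; apply: measurable_cfunM => //; exact: measurable_cfun_cst.
  apply: measurable_cfunM; apply: measurable_cfunB; try exact: measurable_cfun_cst;
    apply: measurable_cfunM; try exact: measurable_cfunM; apply: measurable_cfunV; exact: measurable_cfunM.
apply: measurable_cfunM; apply: measurable_cfunB; try exact: measurable_cfun_cst; exact: measurable_cfunM.
Qed.

Lemma measurable_Hartogs : measurable (@Hartogs R).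
Proof.
have mid : measurable_fun setT (fun w : C2pt R => w) by exact: measurable_id.
have m1 := measurable_cmod _ (measurable_cfun_zc1 _ _ _ mid).
have m2 := measurable_cmod _ (measurable_cfun_zc2 _ _ _ mid).
rewrite (_ : @Hartogs R = [set w : C2pt R | cmod (zc1 w) < cmod (zc2 w)] `&`
   [set w | cmod (zc2 w) < 1]); last first.
  by apply/seteqP; split => w; [case/andP|case=> h1 h2; apply/andP].
apply: measurableI.
  have := measurable_fun_ltr m1 m2; move=> /(_ measurableT [set true] I).
  by rewrite setTI.
have := measurable_fun_ltr m2 (measurable_cst (1 : R)); move=> /(_ measurableT [set true] I).
by rewrite setTI.
Qed.

(** The kernel is Hermitian: conjugation exchanges its arguments. This lets the Schur estimate run
    in either variable. *)
Lemma cmod_KHC z w : cmod (KH z w) = cmod (KH w z).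
Proof.
rewrite /cmod -[LHS]normc_conj /KH; cbv zeta; congr (Normc.normc _).
rewrite conjc_inv; congr (_^-1).
have conjB (x : R[i]) : conjc (1 - x) = 1 - conjc x by rewrite rmorphB rmorph1.
have conjM (x y : R[i]) : conjc (x * y) = conjc x * conjc y by rewrite rmorphM.
rewrite !expr2 !conjM !conjB !conjM conjc_inv !conjM !conjcK conjc_real.
rewrite (mulrC (conjc (zc1 z))) (mulrC (conjc (zc2 z)) (zc2 w)).
by congr (_ * _ * _); ring.
Qed.

(* Vanishes off the Hartogs triangle, since 0 `^ (- s) = 0. *)
Definition schur_weight s g w : R :=
  (Num.max (1 - cmod (zc1 w) / cmod (zc2 w)) 0) `^ (- s) *
  (Num.max (1 - cmod (zc2 w)) 0) `^ (- s) * (cmod (zc2 w)) `^ (- (1 + g)).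

Lemma schur_weight_ge0 s g w : 0 <= schur_weight s g w.
Proof. by rewrite !mulr_ge0 ?powR_ge0. Qed.

Lemma schur_weight_out s g w : 0 < s -> 0 < g -> ~ Hartogs w ->
  schur_weight s g w = 0.
Proof.
move=> s0 g0 Hw; rewrite /schur_weight.
have sn : - s != 0 by rewrite oppr_eq0 gt_eqF.
have [w1|w1] := leP 1 (cmod (zc2 w)).
  by rewrite [X in _ * X `^ _ * _]max_r ?subr_le0// powR0// mulr0 mul0r.
(* At w2 = 0 the quotient is 0 by convention and the first factor is 1; it is the last factor, a
   nonzero power of 0, that vanishes. *)
have [w2|w2] := eqVneq (cmod (zc2 w)) 0.
  by rewrite w2 (@powR0 _ (- _)) ?mulr0// oppr_eq0 gt_eqF// addr_gt0.
have w20 : 0 < cmod (zc2 w) by rewrite lt_neqAle eq_sym w2 normc_ge0.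
rewrite [X in X `^ _ * _ * _]max_r ?powR0 ?mul0r// subr_le0 ler_pdivlMr// mul1r.
by rewrite leNgt; apply/negP => h; apply: Hw; rewrite /Hartogs/= h w1.
Qed.

Lemma measurable_schur_weight s g : measurable_fun setT (schur_weight s g).
Proof.
have mid : measurable_fun setT (fun w : C2pt R => w) by exact: measurable_id.
have m1 := measurable_cmod _ (measurable_cfun_zc1 _ _ _ mid).
have m2 := measurable_cmod _ (measurable_cfun_zc2 _ _ _ mid).
have mV : measurable_fun setT (fun w : C2pt R => (cmod (zc2 w))^-1).
  under eq_fun do rewrite -powR_inv1 ?normc_ge0//.
  exact: measurable_fun_powR.
apply: measurable_funM; last exact: measurable_fun_powR.
apply: measurable_funM; apply: measurable_fun_powR; apply: measurable_maxr => //;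
  apply: measurable_funB => //.
exact: measurable_funM.
Qed.

End hartogs.

(** * The Schur estimate *)

Section schur_estimate.
Context {R : realType}.
Notation lam := (@lebesgue_measure R).
Implicit Types (s g : R) (z w : C2pt R).

Lemma iterated_integralZl (f : measurableTypeR R * measurableTypeR R -> R) (c : R) :
  measurable_fun setT f -> (forall p, 0 <= f p) -> 0 <= c ->
  (\int[lam]_y \int[lam]_x (c * f (x, y))%:E =
   c%:E * \int[lam]_y \int[lam]_x (f (x, y))%:E)%E.
Proof.
move=> mf f0 c0.
have mE : measurable_fun setT (EFin \o f) by exact/measurable_EFinP.
have f0' p : (0 <= (EFin \o f) p)%E by rewrite lee_fin.
have mI : measurable_fun setT
    (fun y : measurableTypeR R => \int[lam]_x (f (x, y))%:E)%E.
  exact: (@measurable_fun_fubini_tonelli_G _ _ _ _ R lam (EFin \o f) mE f0').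
rewrite -ge0_integralZl_EFin//; last first.
  by move=> y _; apply: integral_ge0 => x _; rewrite lee_fin.
apply: eq_integral => y _.
under eq_integral do rewrite EFinM.
rewrite ge0_integralZl_EFin//; first by move=> x _; rewrite lee_fin.
by apply/measurable_EFinP; apply: measurableT_comp mf _; exact: measurable_pair2.
Qed.

Definition schur_bound s z : R :=
  (cmod (zc2 z))^-1 * ((1 - cmod (zc1 z) / cmod (zc2 z)) `^ (- s) *
                       (1 - cmod (zc2 z)) `^ (- s)).

(** For fixed w2 the w1-integral is a [disk_integral] of radius |w2|. All powers of |w2| then
    combine to |w2|^(-g), and what remains in w2 is a [weighted_disk_integral] on the unit disc. *)
Lemma schur_estimate s g : 0 < s -> s < 1 -> 0 < g -> g < 2 ->
  exists C : R, 0 < C /\ forall z, Hartogs z ->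
  (\int[@vol R]_w (cmod (KH z w) * schur_weight s g w)%:E <=
   (C * schur_bound s z)%:E)%E.
Proof.
move=> s0 s1 g0 g2.
have [C1 [C10 HC1]] := @disk_integral R s s0 s1.
have [C2 [C20 HC2]] := @weighted_disk_integral R s g s0 s1 g0 g2.
exists (C1 * C2); split; first exact: mulr_gt0.
move=> z Hz; have /andP[z12 z21] : cmod (zc1 z) < cmod (zc2 z) < 1 := Hz.
have z20 : 0 < cmod (zc2 z) by apply: le_lt_trans z12; exact: normc_ge0.
have F0 w : 0 <= cmod (KH z w) * schur_weight s g w.
  by rewrite mulr_ge0 ?normc_ge0 ?schur_weight_ge0.
have mF : measurable_fun setT (fun w : C2pt R => cmod (KH z w) * schur_weight s g w).
  apply: measurable_funM; last exact: measurable_schur_weight.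
  by apply: measurable_cmod; apply: measurable_cfun_KH; [exact: measurable_cst|exact: measurable_id].
rewrite vol_tonelli; last 2 first.
- exact/measurable_EFinP.
- by move=> w; rewrite lee_fin.
pose A := (1 - cmod (zc1 z) / cmod (zc2 z)) `^ (- s).
pose D (x y : R) := disk_kernel s 1 (z.2.2.1 : R) (z.2.2.2 : R) x y * hypot x y `^ (- g).
pose c := (cmod (zc2 z))^-1 * C1 * A.
have c0 : 0 <= c by rewrite !mulr_ge0 ?powR_ge0 ?invr_ge0 ?(ltW z20) ?(ltW C10).
have D0 x y : 0 <= D x y by rewrite mulr_ge0 ?powR_ge0 ?disk_kernel_ge0.
have inner (x2 y2 : R) :
    (\int[lam]_y1 \int[lam]_x1 (cmod (KH z ((x1, (y1, (x2, y2))) : C2pt R)) *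
       schur_weight s g (x1, (y1, (x2, y2))))%:E <= (c * D x2 y2)%:E)%E.
  pose rho := hypot x2 y2.
  have [/andP[r0 r1]|r01] := boolP ((0 < rho) && (rho < 1)); last first.
    rewrite integral0_eq; first by rewrite lee_fin (mulr_ge0 c0 (D0 _ _)).
    move=> y1 _.
    rewrite integral0_eq// => x1 _; rewrite schur_weight_out ?mulr0// => Hw.
    have /andP[h1 h2] : hypot x1 y1 < rho < 1 := Hw.
    by move/negP: r01; apply; rewrite h2 (le_lt_trans _ h1)// hypot_ge0.
  pose b := zc1 z * (x2 +i* y2)%C / zc2 z.
  pose b1 : R := complex.Re b; pose b2 : R := complex.Im b.
  have bE : cmod b = hypot b1 b2 by rewrite /b1 /b2; case: (b).
  have nb : hypot b1 b2 = cmod (zc1 z) / cmod (zc2 z) * rho.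
    by rewrite -bE /b /cmod !Normc.normcM Normc.normcV normc_hypot mulrAC.
  have brho : hypot b1 b2 < rho.
    by rewrite nb gtr_pMl// ltr_pdivrMr// mul1r.
  (* The power s - g of rho collects rho from the kernel bound, rho^(-1-g) from the weight, and
     rho^s from 1 - |w1| / rho = (rho - |w1|) / rho. *)
  pose k := (cmod (zc2 z))^-1 * (rho `^ (s - g) *
    disk_kernel s 1 (z.2.2.1 : R) (z.2.2.2 : R) x2 y2).
  have k0 : 0 <= k.
    apply: mulr_ge0; first by rewrite invr_ge0 ltW.
    by rewrite mulr_ge0 ?powR_ge0 ?disk_kernel_ge0.
  apply: (@le_trans _ _ (\int[lam]_y1 \int[lam]_x1
      (k * disk_kernel s rho b1 b2 (x1, y1).1 (x1, y1).2)%:E)%E).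
    apply: le_integral_ge0 => y1 _.
      by apply: integral_ge0 => x1 _; rewrite lee_fin.
    apply: le_integral_ge0 => x1 _; first by rewrite lee_fin.
    rewrite lee_fin /=.
    have [Hw|Hw] := pselect (Hartogs ((x1, (y1, (x2, y2))) : C2pt R)); last first.
      by rewrite schur_weight_out// mulr0 mulr_ge0// disk_kernel_ge0.
    have := normc_KH_le _ _ Hz Hw; cbv zeta; move=> [_].
    set w : C2pt R := (x1, (y1, (x2, y2))).
    have -> : cmod (zc2 w) = rho by [].
    have -> : cmod (zc1 w) = hypot x1 y1 by [].
    have -> : cmod (zc1 z * zc2 w / zc2 z) = hypot b1 b2 by exact: bE.
    have -> : cmod (zc1 w - zc1 z * zc2 w / zc2 z) = hypot (x1 - b1) (y1 - b2).
      by change (cmod (zc1 w - b) = hypot (x1 - b1) (y1 - b2)); rewrite /b1 /b2; case: (b).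
    have -> : cmod (zc2 w - zc2 z) = hypot (x2 - z.2.2.1) (y2 - z.2.2.2) by [].
    have /andP[w12 w21] : hypot x1 y1 < rho < 1 := Hw.
    set N1 := Num.max _ (rho - _); set N2 := Num.max _ (1 - rho) => h.
    apply: (le_trans (ler_wpM2r (schur_weight_ge0 s g w) h)).
    rewrite /k /disk_kernel -/rho /schur_weight.
    have -> : cmod (zc2 w) = rho by [].
    have -> : cmod (zc1 w) = hypot x1 y1 by [].
    have -> : hypot (z.2.2.1 : R) (z.2.2.2 : R) = cmod (zc2 z) by [].
    rewrite -/N1 -/N2.
    have q1 : 0 <= rho - hypot x1 y1 by rewrite subr_ge0 ltW.
    rewrite [Num.max (rho - _) 0]max_l//.
    have -> : 1 - hypot x1 y1 / rho = (rho - hypot x1 y1) / rho.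
      by field; rewrite gt_eqF.
    rewrite [Num.max (_ / rho) 0]max_l; last by rewrite divr_ge0// ltW.
    rewrite powRM// ?invr_ge0 ?(ltW r0)// powR_invN//.
    rewrite le_eqVlt; apply/orP; left; apply/eqP.
    have -> : - (1 + g) = - 1 - g by ring.
    rewrite (powRD (x := rho) (r := -1)); last by rewrite (gt_eqF r0) implybT.
    rewrite (powRD (x := rho) (r := s)); last by rewrite (gt_eqF r0) implybT.
    rewrite powR_inv1 ?(ltW r0)//.
    by field; rewrite !gt_eqF.
  have mD := measurable_disk_kernel s rho b1 b2.
  rewrite (iterated_integralZl _ _ mD)//; last by move=> p; exact: disk_kernel_ge0.
  apply: (@le_trans _ _ (k%:E * (C1 * (rho - hypot b1 b2) `^ (- s))%:E)%E).
    by apply: lee_wpmul2l; [rewrite lee_fin|exact: HC1].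
  rewrite -EFinM lee_fin nb.
  (* Scaling: (rho - |b|)^(-s) yields a factor rho^(-s), which cancels rho^s and leaves rho^(-g). *)
  have -> : rho - cmod (zc1 z) / cmod (zc2 z) * rho =
    rho * (1 - cmod (zc1 z) / cmod (zc2 z)) by ring.
  rewrite powRM ?(ltW r0)//; last by rewrite subr_ge0 ler_pdivrMr// mul1r ltW.
  rewrite -/A /k /c /D -/rho powRD; last by rewrite (gt_eqF r0) implybT.
  rewrite (powRN rho s).
  rewrite le_eqVlt; apply/orP; left; apply/eqP; field.
  by rewrite !gt_eqF ?powR_gt0.
apply: (@le_trans _ _ (\int[lam]_y2 \int[lam]_x2 (c * D (x2, y2).1 (x2, y2).2)%:E)%E).
  apply: le_integral_ge0 => y2 _.
    do 3 (apply: integral_ge0 => ? _); by rewrite lee_fin.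
  apply: le_integral_ge0 => x2 _; last exact: inner.
  by do 2 (apply: integral_ge0 => ? _); rewrite lee_fin.
have mD : measurable_fun setT (fun p : measurableTypeR R * measurableTypeR R => D p.1 p.2).
  apply: measurable_funM; first exact: measurable_disk_kernel.
  by rewrite /hypot; measurability.
rewrite (iterated_integralZl _ _ mD)//.
apply: (@le_trans _ _ (c%:E * (C2 * (1 - cmod (zc2 z)) `^ (- s))%:E)%E).
  by apply: lee_wpmul2l; [rewrite lee_fin|exact: HC2].
rewrite -EFinM lee_fin /c /schur_bound -/A.
by rewrite le_eqVlt; apply/orP; left; apply/eqP; ring.
Qed.

End schur_estimate.

(** * Pointwise inequalities between the Schur weights *)

Section young_weights.
Context {R : realType}.
Implicit Types (s g e : R) (z w : C2pt R).

(** If u <= c the last term suffices; if u > c, then u = u^(4/3) u^(-1/3) <= u^(4/3) c^(-1/3). *)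
Lemma le_young_powR (u c : R) : 0 <= u -> 0 < c ->
  u <= u `^ (4 / 3) * c `^ (- 3^-1) + c.
Proof.
move=> u0 c0; have [uc|cu] := leP u c.
  by rewrite (le_trans uc)// lerDr mulr_ge0 ?powR_ge0.
have u0' : 0 < u by exact: lt_trans cu.
apply: (@le_trans _ _ (u `^ (4 / 3) * u `^ (- 3^-1))).
  rewrite -powRD; last by rewrite (gt_eqF u0') implybT.
  by rewrite (_ : 4 / 3 - 3^-1 = 1) ?powRr1//; field.
rewrite -[leLHS]addr0 lerD ?(ltW c0)//.
by rewrite ler_wpM2l ?powR_ge0// powRN_anti// ltW.
Qed.

Lemma Hartogs_factors z : Hartogs z ->
  [/\ 0 < cmod (zc2 z), cmod (zc2 z) < 1, 0 < 1 - cmod (zc2 z)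
    & 0 < 1 - cmod (zc1 z) / cmod (zc2 z)].
Proof.
move=> Hz; have /andP[z12 z21] : cmod (zc1 z) < cmod (zc2 z) < 1 := Hz.
have z20 : 0 < cmod (zc2 z) by apply: le_lt_trans z12; exact: normc_ge0.
by split => //; rewrite subr_gt0// ltr_pdivrMr// mul1r.
Qed.

Lemma schur_bound_gt0 s z : Hartogs z -> 0 < schur_bound s z.
Proof.
by case/Hartogs_factors => *; rewrite !mulr_gt0 ?invr_gt0 ?powR_gt0.
Qed.

Lemma schur_weight_gt0 s g z : Hartogs z -> 0 < schur_weight s g z.
Proof.
case/Hartogs_factors => *.
by rewrite !mulr_gt0 ?powR_gt0// lt_max; apply/orP; left.
Qed.

(** The factor eta^(-1/3) brings in this cube root. As |z2| < 1, raising |z2|^(-1/3) to |z2|^(-1-g)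
    gives a weight to which [schur_estimate] applies again. *)
Lemma schur_bound_root s g z : 0 <= g -> Hartogs z ->
  schur_bound s z `^ (3^-1) <= schur_weight (s / 3) g z.
Proof.
move=> g0 /Hartogs_factors[z0 z1 B0 A0].
rewrite /schur_weight !max_l ?(ltW A0) ?(ltW B0)// /schur_bound.
rewrite -powR_inv1 ?(ltW z0)// !powRM ?mulr_ge0 ?powR_ge0// -!powRrM.
rewrite -!mulNr mulN1r mulrC ler_wpM2l ?mulr_ge0 ?powR_ge0//.
by apply: ger_powR; rewrite ?z0 ?(ltW z1)// ; lra.
Qed.

(** The boundary factors cancel, s/3 against s/3, and |w2| keeps the exponent (3 - 3 e)/3 - 1 =
    -e. *)
Lemma schur_weight_bound s e w : Hartogs w ->
  schur_weight s (2 - 3 * e) w `^ (- 3^-1) * schur_bound (s / 3) w =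
  cmod (zc2 w) `^ (- e).
Proof.
move=> /Hartogs_factors[w0 w1 B0 A0].
rewrite /schur_weight !max_l ?(ltW A0) ?(ltW B0)// /schur_bound.
set a := 1 - _ / _ in A0 *; set b := 1 - _ in B0 *; set r := cmod _ in w0 *.
rewrite !powRM ?mulr_ge0 ?powR_ge0// -!powRrM.
have K (x p : R) : 0 < x -> x `^ (- p * - 3^-1) * x `^ (- (p / 3)) = 1.
  move=> x0; rewrite -powRD; last by rewrite (gt_eqF x0) implybT.
  by rewrite (_ : _ + _ = 0) ?powRr0//; field.
rewrite [LHS](_ : _ = (a `^ (- s * - 3^-1) * a `^ (- (s / 3))) *
  (b `^ (- s * - 3^-1) * b `^ (- (s / 3))) *
  (r `^ (- (1 + (2 - 3 * e)) * - 3^-1) * r^-1)); last by ring.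
rewrite !K// !mul1r -[r^-1]powR_inv1 ?(ltW w0)// -powRD.
  by congr (_ `^ _); field.
by rewrite (gt_eqF w0) implybT.
Qed.

End young_weights.

Section parametric_integral.
Context {R : realType}.
Local Notation volR := (@vol R).

Lemma le_abs_Rintegral d (T : measurableType d) (mu : {measure set T -> \bar R})
    (u : T -> R) : measurable_fun setT u ->
  ((`|Rintegral mu setT u|)%:E <= \int[mu]_x (`|u x|)%:E)%E.
Proof.
move=> mu_; have mE : measurable_fun setT (EFin \o u) by exact/measurable_EFinP.
have := le_abse_integral mu measurableT mE.
rewrite /Rintegral; apply: le_trans.
(* An infinite integral is sent to 0 by [fine], so the inequality persists. *)
by case: (\int[mu]_x _)%E => [r| |] //=; rewrite normr0 leey.
Qed.

(** Tonelli gives measurability for the positive and the negative part separately. *)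
Lemma measurable_Rintegral_param (u : C2pt R * C2pt R -> R) :
  measurable_fun setT u ->
  measurable_fun setT (fun z => Rintegral volR setT (fun w => u (z, w))).
Proof.
move=> mu_; have mE : measurable_fun setT (EFin \o u) by exact/measurable_EFinP.
pose E := (EFin \o u : C2pt R * C2pt R -> \bar R).
rewrite /Rintegral; apply: (measurableT_comp (f := fine)) => //.
rewrite (_ : (fun z => _) = (fun z : C2pt R =>
    \int[vol_sf]_w (E^\+%E (z, w)) - \int[vol_sf]_w (E^\-%E (z, w)))%E); last first.
  apply/funext => z; rewrite integralE; congr (_ - _)%E; apply: eq_integral => w _.
    by rewrite !funeposE.
  by rewrite !funenegE.
apply: emeasurable_funB.
- apply: (@measurable_fun_fubini_tonelli_F _ _ _ _ R vol_sf E^\+%E).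
    exact: measurable_funepos.
  by move=> p; exact: funepos_ge0.
- apply: (@measurable_fun_fubini_tonelli_F _ _ _ _ R vol_sf E^\-%E).
    exact: measurable_funeneg.
  by move=> p; exact: funeneg_ge0.
Qed.

End parametric_integral.

(** * The weak-type estimate *)

Section bergman_projection.
Context {R : realType}.
Implicit Types (f : C2pt R -> R[i]) (z w : C2pt R).
Local Notation volR := (@vol R).

(** Extension by zero: [f] is only known to be measurable on the triangle, while the product
    arguments run on the whole space. *)
Definition hartogs_cut f w : R[i] := if w \in @Hartogs R then f w else 0.

Lemma hartogs_cut_out f w : ~ Hartogs w -> hartogs_cut f w = 0.
Proof. by move=> Hw; rewrite /hartogs_cut memNset. Qed.

Lemma measurable_cfun_hartogs_cut f : cmeasurable (@Hartogs R) f -> measurable_cfun (hartogs_cut f).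
Proof.
move=> [f1 f2]; have mH := @measurable_Hartogs R; split.
- rewrite (_ : (fun w => complex.Re _) = (fun w => complex.Re (f w)) \_ (@Hartogs R)).
    exact/(measurable_restrictT _ mH).
  by apply/funext => w; rewrite patchE /hartogs_cut; case: ifP.
- rewrite (_ : (fun w => complex.Im _) = (fun w => complex.Im (f w)) \_ (@Hartogs R)).
    exact/(measurable_restrictT _ mH).
  by apply/funext => w; rewrite patchE /hartogs_cut; case: ifP.
Qed.

Lemma BprojE f z : Bproj f z =
  ((Rintegral volR setT (fun w => complex.Re (KH z w * hartogs_cut f w))) +i*
  (Rintegral volR setT (fun w => complex.Im (KH z w * hartogs_cut f w))))%C.
Proof.
rewrite /Bproj /cintegral /Rintegral; congr (fine _ +i* fine _)%C.
  rewrite integral_mkcond; apply: eq_integral => w _; rewrite patchE /hartogs_cut.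
  by case: ifP => // _; rewrite mulr0.
rewrite integral_mkcond; apply: eq_integral => w _; rewrite patchE /hartogs_cut.
by case: ifP => // _; rewrite mulr0.
Qed.

Lemma measurable_cfun_KH_cut f : cmeasurable (@Hartogs R) f ->
  measurable_cfun (fun p : C2pt R * C2pt R => KH p.1 p.2 * hartogs_cut f p.2).
Proof.
move=> /measurable_cfun_hartogs_cut [f1 f2]; apply: measurable_cfunM.
  by apply: measurable_cfun_KH; [exact: measurable_fst|exact: measurable_snd].
by split; [apply: measurableT_comp f1 _|apply: measurableT_comp f2 _];
  exact: measurable_snd.
Qed.

Lemma measurable_cfun_Bproj f : cmeasurable (@Hartogs R) f -> measurable_cfun (Bproj f).
Proof.
move=> mf; have [u1 u2] := measurable_cfun_KH_cut f mf.
split.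
- rewrite (_ : (fun z => complex.Re _) = (fun z => Rintegral volR setT
    (fun w => complex.Re (KH z w * hartogs_cut f w)))).
    exact: (measurable_Rintegral_param _ u1).
  by apply/funext => z; rewrite BprojE.
- rewrite (_ : (fun z => complex.Im _) = (fun z => Rintegral volR setT
    (fun w => complex.Im (KH z w * hartogs_cut f w)))).
    exact: (measurable_Rintegral_param _ u2).
  by apply/funext => z; rewrite BprojE.
Qed.

Lemma hypot_le_norm (x y : R) : hypot x y <= `|x| + `|y|.
Proof.
rewrite -ler_sqr ?nnegrE ?hypot_ge0 ?addr_ge0// sqr_hypot sqrrD.
by rewrite !real_normK ?num_real// -addrA lerD2l lerDr mulrn_wge0 ?mulr_ge0.
Qed.

(** The factor 2 comes from bounding real and imaginary parts separately. *)
Lemma cmod_Bproj_le f z : cmeasurable (@Hartogs R) f ->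
  ((cmod (Bproj f z))%:E <=
   2%:E * \int[volR]_w (cmod (KH z w) * cmod (hartogs_cut f w))%:E)%E.
Proof.
move=> mf.
have [v1 v2] : measurable_cfun (fun w => KH z w * hartogs_cut f w).
  apply: measurable_cfunM; last exact: measurable_cfun_hartogs_cut.
  by apply: measurable_cfun_KH; [exact: measurable_cst|exact: measurable_id].
rewrite BprojE; set a := Rintegral _ _ _; set b := Rintegral _ _ _.
apply: (@le_trans _ _ (`|a| + `|b|)%:E); first by rewrite lee_fin hypot_le_norm.
rewrite EFinD mule_natl mule2n; apply: leeD.
  apply: (le_trans (le_abs_Rintegral _ _ volR _ v1)).
  apply: le_integral_ge0 => w _; rewrite lee_fin//.
  by rewrite /cmod -Normc.normcM; case: (_ * _) => p q; exact: ler_norm_hypotl.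
apply: (le_trans (le_abs_Rintegral _ _ volR _ v2)).
apply: le_integral_ge0 => w _; rewrite lee_fin//.
by rewrite /cmod -Normc.normcM; case: (_ * _) => p q; exact: ler_norm_hypotr.
Qed.

Lemma measurable_superlevel_Bproj f (l : R) : cmeasurable (@Hartogs R) f ->
  measurable [set z | @Hartogs R z /\ l < cmod (Bproj f z)].
Proof.
move=> mf; have mB := measurable_cmod _ (measurable_cfun_Bproj f mf).
rewrite (_ : [set z | _] = @Hartogs R `&` [set z | l < cmod (Bproj f z)]); last by [].
apply: measurableI; first exact: measurable_Hartogs.
have := measurable_fun_ltr (measurable_cst l) mB; move=> /(_ measurableT [set true] I).
by rewrite setTI.
Qed.

Lemma wpow_intE (p eps : R) f : 0 < p ->
  wpow_int p (wz2 eps) f =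
  (\int[volR]_w (cmod (hartogs_cut f w) `^ p * wz2 eps w)%:E)%E.
Proof.
move=> p0; rewrite /wpow_int integral_mkcond; apply: eq_integral => w _.
rewrite patchE /hartogs_cut; case: ifP => // _.
by rewrite /cmod Normc.normc0 powR0 ?mul0r// gt_eqF.
Qed.

End bergman_projection.

Section weak_type.
Context {R : realType}.
Implicit Types z w : C2pt R.
Context (eps lam C1 C2 e s : R) (f : C2pt R -> R[i]).
Context (lam0 : 0 < lam) (C10 : 0 < C1) (C20 : 0 < C2).
Context (e1 : e < 2 / 3) (e_le : e <= eps).
Context (mf : cmeasurable (@Hartogs R) f).
Let g : R := 2 - 3 * e.
Context (HC1 : forall z, Hartogs z ->
  (\int[@vol R]_w (cmod (KH z w) * schur_weight s g w)%:E <=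
   (C1 * schur_bound s z)%:E)%E).
Context (HC2 : forall z, Hartogs z ->
  (\int[@vol R]_w (cmod (KH z w) * schur_weight (s / 3) g w)%:E <=
   (C2 * schur_bound (s / 3) z)%:E)%E).
(** Chosen so that (4 / lam) eta^(-1/3) = kappa m^(1/3) for eta = lam / (4 C1 m), where m is the
    Schur bound at z. *)
Let kappa : R := 4 * (4 * C1) `^ (3^-1) / lam `^ (4 / 3).
Let G w : R := cmod (hartogs_cut f w) `^ (4 / 3) * schur_weight s g w `^ (- 3^-1).

Let g0 : 0 < g. Proof. by rewrite /g subr_gt0 -ltr_pdivlMl// mulrC. Qed.

Let kappa0 : 0 < kappa.
Proof. by rewrite !mulr_gt0 ?invr_gt0 ?powR_gt0 ?mulr_gt0. Qed.

Let G0 w : 0 <= G w. Proof. by rewrite mulr_ge0 ?powR_ge0. Qed.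

Let mG : measurable_fun setT G.
Proof.
apply: measurable_funM; apply: measurable_fun_powR; last exact: measurable_schur_weight.
exact/measurable_cmod/measurable_cfun_hartogs_cut.
Qed.

Let mK z : measurable_fun setT (fun w => cmod (KH z w)).
Proof.
by apply: measurable_cmod; apply: measurable_cfun_KH; [exact: measurable_cst|exact: measurable_id].
Qed.

Let K0 z w : 0 <= cmod (KH z w). Proof. exact: normc_ge0. Qed.

Let pointwise z w (eta : R) : 0 < eta ->
  cmod (KH z w) * cmod (hartogs_cut f w) <=
  eta `^ (- 3^-1) * (cmod (KH z w) * G w) +
  eta * (cmod (KH z w) * schur_weight s g w).
Proof.
move=> eta0; rewrite mulrCA (mulrCA eta) -mulrDr ler_wpM2l//.
have [Hw|Hw] := pselect (Hartogs w); last first.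
  rewrite hartogs_cut_out// [leLHS]Normc.normc0 addr_ge0// mulr_ge0 ?powR_ge0//.
    exact: ltW.
  exact: schur_weight_ge0.
have W0 := schur_weight_gt0 s g w Hw.
apply: le_trans (le_young_powR _ (eta * schur_weight s g w) (normc_ge0 _) _) _.
  exact: mulr_gt0.
by rewrite powRM ?(ltW eta0) ?(ltW W0)// mulrCA.
Qed.

(** A pointwise Chebyshev inequality: |P f| <= 2 int |K| |f| and the W-term is at most lam/4, so the
    other term exceeds lam/4; dividing by lam/4 normalises the left side to 1. *)
Let level z : Hartogs z -> lam < cmod (Bproj f z) ->
  (1 <= (kappa * schur_weight (s / 3) g z)%:E *
        \int[@vol R]_w (cmod (KH z w) * G w)%:E)%E.
Proof.
move=> Hz Hlam; set X := (\int[_]_w _)%E.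
have X0 : (0 <= X)%E.
  by apply: integral_ge0 => w _; rewrite lee_fin mulr_ge0.
have m0 := schur_bound_gt0 s z Hz; set m := schur_bound s z in m0.
have T0 := schur_weight_gt0 (s / 3) g z Hz.
pose eta := lam / (4 * C1 * m).
have D0 : 0 < 4 * C1 * m by apply: mulr_gt0 => //; exact: mulr_gt0.
have eta0 : 0 < eta by rewrite divr_gt0.
pose q := eta `^ (- 3^-1).
have q0 : 0 < q by exact: powR_gt0.
have Y : (\int[@vol R]_w (cmod (KH z w) * cmod (hartogs_cut f w))%:E <=
    q%:E * X + (lam / 4)%:E)%E.
  apply: (@le_trans _ _ (\int[@vol R]_w (q%:E * (cmod (KH z w) * G w)%:E +
      eta%:E * (cmod (KH z w) * schur_weight s g w)%:E))%E).
    apply: le_integral_ge0 => w _; first by rewrite lee_fin mulr_ge0// normc_ge0.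
    by rewrite -!EFinM -EFinD lee_fin pointwise.
  have mKG : measurable_fun setT (fun w => (cmod (KH z w) * G w)%:E).
    by apply/measurable_EFinP; exact: measurable_funM.
  have mKW : measurable_fun setT (fun w => (cmod (KH z w) * schur_weight s g w)%:E).
    by apply/measurable_EFinP; apply: measurable_funM => //; exact: measurable_schur_weight.
  have KG0 w : (0 <= (cmod (KH z w) * G w)%:E)%E by rewrite lee_fin mulr_ge0.
  have KW0 w : (0 <= (cmod (KH z w) * schur_weight s g w)%:E)%E.
    by rewrite lee_fin mulr_ge0// schur_weight_ge0.
  rewrite ge0_integralD; [|exact: measurableT| | | |]; last 4 first.
  - by move=> w _; rewrite mule_ge0// lee_fin ltW.
  - exact: measurable_funeM.
  - by move=> w _; rewrite mule_ge0// lee_fin ltW.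
  - exact: measurable_funeM.
  rewrite !ge0_integralZl_EFin//; [|exact: ltW|exact: ltW].
  apply: leeD => //.
  apply: (@le_trans _ _ (eta%:E * (C1 * m)%:E)%E).
    by apply: lee_wpmul2l; [rewrite lee_fin ltW|exact: HC1].
  rewrite -EFinM lee_fin /eta le_eqVlt; apply/orP; left; apply/eqP.
  by field; rewrite !gt_eqF.
have B := cmod_Bproj_le f z mf.
have kT : 0 < kappa * schur_weight (s / 3) g z by rewrite mulr_gt0.
have qE : 4 / lam * q = kappa * m `^ (3^-1).
  rewrite /q /eta powRM ?invr_ge0 ?(ltW lam0) ?(ltW D0)// powR_invN//.
  rewrite powRM ?(ltW m0) ?mulr_ge0 ?(ltW C10)// /kappa -(powRN lam (4 / 3)).
  have -> : - (4 / 3) = - 1 - 3^-1 :> R by field.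
  rewrite (powRD (x := lam)); last by rewrite (gt_eqF lam0) implybT.
  by rewrite powR_inv1 ?(ltW lam0)//; ring.
(* If X is infinite the claim is immediate, its coefficient being positive. *)
clearbody X; case: X X0 Y => [x| |] // x0 Y; last first.
  by rewrite gt0_muley ?lte_fin// leey.
have Y2 : lam < 2 * (q * x + lam / 4).
  rewrite -lte_fin; apply: (@lt_le_trans _ _ (cmod (Bproj f z))%:E) => //.
  apply: (le_trans B); rewrite EFinM.
  by apply: lee_wpmul2l; [rewrite lee_fin|exact: Y].
rewrite lee_fin in x0.
rewrite -EFinM lee_fin; apply: (@le_trans _ _ (kappa * m `^ (3^-1) * x)).
  rewrite -qE (_ : 4 / lam * q * x = 4 * (q * x) / lam); last by ring.
  by rewrite ler_pdivlMr// mul1r; lra.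
by rewrite ler_wpM2r// ler_pM2l// schur_bound_root// ltW.
Qed.

(** By Hermitian symmetry the z-integral is the Schur estimate at w with s/3; [schur_weight_bound]
    turns the outcome into |w2|^(-e), at most |w2|^(-eps) since |w2| < 1. *)
Let column w :
  (\int[@vol R]_z (kappa * schur_weight (s / 3) g z * (cmod (KH z w) * G w))%:E <=
   (kappa * C2 * (cmod (hartogs_cut f w) `^ (4 / 3) * wz2 eps w))%:E)%E.
Proof.
have [Hw|Hw] := pselect (Hartogs w); last first.
  rewrite integral0_eq; last first.
    move=> z _; rewrite /G hartogs_cut_out// /cmod Normc.normc0 powR0 ?mul0r ?mulr0 ?gt_eqF//.
  by rewrite lee_fin; apply: mulr_ge0; apply: mulr_ge0; rewrite ?powR_ge0//; exact: ltW.
have [w0 w1 _ _] := Hartogs_factors w Hw.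
have E z : kappa * schur_weight (s / 3) g z * (cmod (KH z w) * G w) =
    (kappa * G w) * (cmod (KH w z) * schur_weight (s / 3) g z).
  by rewrite cmod_KHC; ring.
under eq_integral do rewrite E EFinM.
rewrite ge0_integralZl_EFin; [|exact: measurableT| | |]; last 3 first.
- by move=> z _; rewrite lee_fin mulr_ge0// schur_weight_ge0.
- apply/measurable_EFinP; apply: measurable_funM => //.
  exact: measurable_schur_weight.
- by rewrite mulr_ge0// ltW.
apply: (@le_trans _ _ ((kappa * G w)%:E * (C2 * schur_bound (s / 3) w)%:E)%E).
  by apply: lee_wpmul2l; [rewrite lee_fin mulr_ge0// ltW|exact: HC2].
rewrite -EFinM lee_fin /G.
have -> : kappa * (cmod (hartogs_cut f w) `^ (4 / 3) * schur_weight s g w `^ (- 3^-1)) *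
    (C2 * schur_bound (s / 3) w) = kappa * C2 * (cmod (hartogs_cut f w) `^ (4 / 3) *
    (schur_weight s g w `^ (- 3^-1) * schur_bound (s / 3) w)) by ring.
rewrite schur_weight_bound//.
apply: ler_wpM2l; first by rewrite mulr_ge0// ltW.
apply: ler_wpM2l; first exact: powR_ge0.
by apply: ger_powR; [rewrite w0 ltW|rewrite lerN2].
Qed.

Lemma weak_type_estimate :
  (@vol R [set z | @Hartogs R z /\ (lam < cmod (Bproj f z))%R] <=
   (4 * (4 * C1) `^ (3^-1) * C2 / lam `^ (4 / 3))%R%:E *
     wpow_int (4 / 3) (wz2 eps) f)%E.
Proof.
set S := [set z | _].
have mS : measurable S by exact: measurable_superlevel_Bproj.
pose Q (p : C2pt R * C2pt R) : \bar R :=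
  (kappa * schur_weight (s / 3) g p.1 * (cmod (KH p.1 p.2) * G p.2))%:E.
have Q0 p : (0 <= Q p)%E.
  rewrite lee_fin; apply: mulr_ge0; apply: mulr_ge0 => //; first exact: ltW.
  exact: schur_weight_ge0.
have mQ : measurable_fun setT Q.
  have m1 : measurable_fun setT (fun p : C2pt R * C2pt R => p.1) by exact: measurable_fst.
  have m2 : measurable_fun setT (fun p : C2pt R * C2pt R => p.2) by exact: measurable_snd.
  apply/measurable_EFinP; apply: measurable_funM.
    apply: measurable_funM; first exact: measurable_cst.
    exact: (measurableT_comp (measurable_schur_weight (s / 3) g) m1).
  apply: measurable_funM; first by apply: measurable_cmod; exact: measurable_cfun_KH.
  exact: (measurableT_comp mG m2).
have swap : (\int[@vol R]_z \int[@vol R]_w Q (z, w) =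
             \int[@vol R]_w \int[@vol R]_z Q (z, w))%E.
  exact: (fubini_tonelli (m1 := vol_sf) (m2 := vol_sf) Q mQ Q0).
have -> : @vol R S = (\int[@vol R]_z (\1_S z)%:E)%E.
  by rewrite (integral_indic _ measurableT mS) setIT.
(* On [S] the inner integral is at least 1 by [level]; elsewhere it is nonnegative. *)
apply: (@le_trans _ _ (\int[@vol R]_z \int[@vol R]_w Q (z, w))%E).
  apply: le_integral_ge0 => z _; first by rewrite lee_fin indicE.
  rewrite indicE; have [|_] := boolP (z \in S); last by apply: integral_ge0.
  rewrite inE => -[Hz Hl]; apply: (le_trans (level z Hz Hl)).
  rewrite -ge0_integralZl_EFin; [|exact: measurableT| | |]; last 3 first.
  - by move=> w _; rewrite lee_fin mulr_ge0.
  - by apply/measurable_EFinP; exact: measurable_funM.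
  - by apply: mulr_ge0; [exact: ltW|exact: schur_weight_ge0].
  rewrite le_eqVlt; apply/orP; left; apply/eqP; apply: eq_integral => w _.
  by rewrite -EFinM.
rewrite swap.
apply: (@le_trans _ _ (\int[@vol R]_w
    ((kappa * C2)%:E * (cmod (hartogs_cut f w) `^ (4 / 3) * wz2 eps w)%:E))%E).
  apply: le_integral_ge0 => w _; first by apply: integral_ge0.
  by rewrite -EFinM; exact: column.
have mid : measurable_fun setT (fun w : C2pt R => w) by exact: measurable_id.
rewrite ge0_integralZl_EFin; [|exact: measurableT| | |]; last 3 first.
- by move=> w _; rewrite lee_fin mulr_ge0 ?powR_ge0.
- apply/measurable_EFinP; apply: measurable_funM; apply: measurable_fun_powR.
    exact/measurable_cmod/measurable_cfun_hartogs_cut.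
  exact/measurable_cmod/measurable_cfun_zc2.
- by apply: mulr_ge0; exact: ltW.
rewrite -wpow_intE; last by rewrite divr_gt0.
have -> : kappa * C2 = 4 * (4 * C1) `^ 3^-1 * C2 / lam `^ (4 / 3).
  exact: mulrAC.
exact: lexx.
Qed.

End weak_type.

Theorem theorem4p6 (R : realType) (eps : R) (heps : 0 < eps) :
  exists C : R, 0 < C /\
    forall (f : C2pt R -> R[i]), inLp_w (4 / 3) (wz2 eps) f ->
    forall lam : R, 0 < lam ->
      (@vol R [set z | @Hartogs R z /\ (lam < cmod (Bproj f z))%R]
        <= (C / lam `^ (4 / 3))%R%:E * wpow_int (4 / 3) (wz2 eps) f)%E.
Proof.
(* The cap 1/3 keeps 2 - 3 e >= 1 for large [eps]. *)
pose e := Num.min eps (3^-1).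
have e0 : 0 < e by rewrite lt_min heps; lra.
have e_le : e <= eps by rewrite ge_min lexx.
have e3 : e <= 3^-1 by rewrite ge_min lexx orbT.
have e1 : e < 2 / 3 by lra.
have g0 : 0 < 2 - 3 * e by lra.
have g2 : 2 - 3 * e < 2 by lra.
(* Any s in (0, 1) would serve; s = 1/2 is taken, with s/3 for the second estimate. *)
have [C1 [C10 HC1]] := @schur_estimate R (2^-1) (2 - 3 * e) ltac:(lra) ltac:(lra) g0 g2.
have [C2 [C20 HC2]] := @schur_estimate R (2^-1 / 3) (2 - 3 * e) ltac:(lra) ltac:(lra) g0 g2.
exists (4 * (4 * C1) `^ (3^-1) * C2); split.
  by apply: mulr_gt0 => //; apply: mulr_gt0 => //; apply: powR_gt0; exact: mulr_gt0.
move=> f [mf _] lam lam0.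
exact: (weak_type_estimate eps lam C1 C2 e (2^-1) f lam0 C10 C20 e1 e_le mf HC1 HC2).
Qed.
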